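(* (a) Suppose that the limit $v(y_0):=\lim_{T\to\infty}v_T(y_0)$ exists for every $y_0\in Y$ and that the limit function $v(\cdot)$ is continuous on $Y$. Then $v(y_0)=d^*(y_0)$ for every $y_0\in Y$. (b) Suppose that the limit $h(y_0):=\lim_{\epsilon\to0}h_\epsilon(y_0)$ exists for every $y_0\in Y$ and that the limit function $h(\cdot)$ is continuous on $Y$. Then $h(y_0)=d^*(y_0)$ for every $y_0\in Y$.
   Context: Model. $Y\subset\mathbb R^n$ is a nonempty compact set, $\hat U$ is a compact metric space, $S$ is a Polish space. The function $f:Y\times\hat U\times S\to\mathbb R^n$ is bounded, continuous in $(y,u)$ on $Y\times\hat U$ and Borel measurable in $s$ on $S$. The $S$-valued random elements $s(0),s(1),\dots$ are independent and identically distributed on a common probability space; $s$ denotes a generic random element with the same distribution, and $E[\varphi(f(y,u,s))]$ is the expectation over $s$ with $(y,u)$ fixed. $U(\cdot)$ is an upper semicontinuous multivalued map from $Y$ to nonempty compact subsets of $\hat U$, and $f(y,u,s)\in Y$ for all $y\in Y$, $u\in U(y)$, $s\in S$. $G:=\{(y,u): y\in Y,\ u\in U(y)\}$ (a compact set). $\Pi$ is the set of control plans $\pi=\{\pi_t(\cdot)\}_{t=0,1,\dots}$, where each $\pi_t:Y\to\hat U$ is Borel measurable with $\pi_t(y)\in U(y)$ for all $y\in Y$. For $\pi\in\Pi$ and $y_0\in Y$, the state-control trajectory $(y^{\pi,y_0}(\cdot),u^{\pi,y_0}(\cdot))$ is defined by $y(0)=y_0$, $u(t)=\pi_t(y(t))$,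 $y(t+1)=f(y(t),u(t),s(t))$. The function $k:Y\times\hat U\to\mathbb R$ is continuous (hence bounded). Optimal values. For $T=1,2,\dots$ and $\epsilon\in(0,1)$, $$v_T(y_0):=\frac1T\min_{\pi\in\Pi}E\Big[\sum_{t=0}^{T-1}k(y^{\pi,y_0}(t),u^{\pi,y_0}(t))\Big],\qquad h_\epsilon(y_0):=\epsilon\min_{\pi\in\Pi}E\Big[\sum_{t=0}^{\infty}(1-\epsilon)^t k(y^{\pi,y_0}(t),u^{\pi,y_0}(t))\Big].$$ Dual problem. $d^*(y_0)$ is the supremum of $\mu$ over all triplets $(\mu,\psi,\eta)\in\mathbb R\times C(Y)\times C(Y)$ ($C(Y)$ the continuous functions on $Y$) such that for all $(y,u)\in G$: $k(y,u)+(\psi(y_0)-\psi(y))+E[\eta(f(y,u,s))]-\eta(y)-\mu\ge0$ and $E[\psi(f(y,u,s))]-\psi(y)\ge0$. *)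

(* Defs.v *)
From HB Require Import structures.
From mathcomp Require Import all_boot all_order all_algebra.
From mathcomp Require Import all_classical all_reals all_analysis.

Set Implicit Arguments.
Unset Strict Implicit.
Unset Printing Implicit Defensive.

Import Order.TTheory GRing.Theory Num.Theory.
Import numFieldNormedType.Exports.

Local Open Scope classical_set_scope.
Local Open Scope ring_scope.

(* Borel sets are taken as plain sets of sets: [g_sigma_algebraType open] would
   require the underlying type to be pointed. *)
Definition borel (T : topologicalType) : set (set T) := <<s @open T >>.

Definition polish_space (R : realType) (T : topologicalType) : Prop :=
  (exists d : T -> T -> R,
    [/\ forall x y, d x y = 0 <-> x = y,
        forall x y, d x y = d y x,
        forall x y z, d x z <= d x y + d y z,
        forall x (A : set T), nbhs x A <->
          exists2 e : R, 0 < e & [set y | d x y < e] `<=` A &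
        forall a : nat -> T,
          (forall e : R, 0 < e -> exists N, forall i j : nat,
             (N <= i)%N -> (N <= j)%N -> d (a i) (a j) < e) ->
          exists l : T, a @ \oo --> l]) /\
  (exists2 D : set T, countable D & dense D).

Definition upper_semicontinuous_on (X V : topologicalType)
    (Y : set X) (U : X -> set V) : Prop :=
  forall y, Y y -> forall O : set V, open O -> U y `<=` O ->
    \forall z \near within Y (nbhs y), U z `<=` O.

Definition random_element d (Om : measurableType d) (S : topologicalType)
    (X : Om -> S) : Prop :=
  forall B, borel B -> measurable (X @^-1` B).

Definition iid d (Om : measurableType d) (R : realType)
    (P : probability Om R) (S : topologicalType) (s : nat -> Om -> S) : Prop :=
  [/\ forall t, random_element (s t),
      forall t (B : set S), borel B -> P (s t @^-1` B) = P (s 0%N @^-1` B) &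
      forall (J : seq nat) (B : nat -> set S), uniq J ->
        (forall t, borel (B t)) ->
        P (\bigcap_(t in [set` J]) (s t @^-1` B t)) =
        (\prod_(t <- J) P (s t @^-1` B t))%E].

(* The set Pi. Only the values of a plan on Y matter; [Y `&` _] expresses Borel
   measurability of the restriction to the (closed) set Y. *)
Definition control_plans (X V : topologicalType) (Y : set X) (U : X -> set V) :
    set (nat -> X -> V) :=
  [set pi | forall t,
     (forall B, borel B -> borel (Y `&` pi t @^-1` B)) /\
     (forall y, Y y -> U y (pi t y))].

Fixpoint state (X V S Om : Type) (f : X -> V -> S -> X) (s : nat -> Om -> S)
    (pi : nat -> X -> V) (y0 : X) (t : nat) (w : Om) : X :=
  if t is t'.+1 then
    let y := state f s pi y0 t' w in f y (pi t' y) (s t' w)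
  else y0.

Definition control (X V S Om : Type) (f : X -> V -> S -> X) (s : nat -> Om -> S)
    (pi : nat -> X -> V) (y0 : X) (t : nat) (w : Om) : V :=
  pi t (state f s pi y0 t w).

(* The optimal values are extended reals, the minimum over plans being rendered
   by [ereal_inf], so that no value is assigned by a default convention. *)
Definition v_ d (Om : measurableType d) (R : realType) (P : probability Om R)
    (X V S : topologicalType) (Y : set X) (U : X -> set V)
    (f : X -> V -> S -> X) (k : X -> V -> R) (s : nat -> Om -> S)
    (T : nat) (y0 : X) : \bar R :=
  ((T%:R^-1)%:E *
   ereal_inf [set 'E_P[fun w => (\sum_(0 <= t < T)
                         k (state f s pi y0 t w) (control f s pi y0 t w))%R]
             | pi in control_plans Y U])%E.

Definition h_ d (Om : measurableType d) (R : realType) (P : probability Om R)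
    (X V S : topologicalType) (Y : set X) (U : X -> set V)
    (f : X -> V -> S -> X) (k : X -> V -> R) (s : nat -> Om -> S)
    (eps : R) (y0 : X) : \bar R :=
  (eps%:E *
   ereal_inf [set 'E_P[fun w => limn (series (fun t => (1 - eps) ^+ t *
                         k (state f s pi y0 t w) (control f s pi y0 t w))%R)]
             | pi in control_plans Y U])%E.

Definition graph_on (X V : Type) (Y : set X) (U : X -> set V) : set (X * V) :=
  [set p | Y p.1 /\ U p.1 p.2].

(* [s 0] plays the role of the generic random element s.  An element of C(Y) is
   a total function continuous on the subspace Y; its values off Y are
   irrelevant since f maps the graph of U into Y. *)
Definition dual_feasible d (Om : measurableType d) (R : realType)
    (P : probability Om R) (X V S : topologicalType)
    (Y : set X) (U : X -> set V) (f : X -> V -> S -> X) (k : X -> V -> R)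
    (s : nat -> Om -> S) (y0 : X) (mu : R) (psi eta : X -> R) : Prop :=
  [/\ {within Y, continuous psi}, {within Y, continuous eta} &
      forall y u, graph_on Y U (y, u) ->
        (0 <= (k y u + (psi y0 - psi y))%:E
              + 'E_P[fun w => eta (f y u (s 0%N w))] - (eta y)%:E - mu%:E)%E /\
        (0 <= 'E_P[fun w => psi (f y u (s 0%N w))] - (psi y)%:E)%E].

Definition dual_value d (Om : measurableType d) (R : realType)
    (P : probability Om R) (X V S : topologicalType)
    (Y : set X) (U : X -> set V) (f : X -> V -> S -> X) (k : X -> V -> R)
    (s : nat -> Om -> S) (y0 : X) : \bar R :=
  ereal_sup [set mu%:E | mu in
    [set mu | exists psi eta, dual_feasible P Y U f k s y0 mu psi eta]].

(* Main.v *)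
(* The limit value [v] is used as [psi], so only [eta] has to be found: for every
   [e > 0], a continuous [eta] with [k - v + E eta(f) - eta >= - e] on the graph.
   Averaging value iterates of the cost [k - v] gives such an [eta] as soon as the
   iterate over some horizon [T] is at least [- e T] on [Y].  Were there no such
   [T], the occupation measures of optimal trajectories over growing horizons would
   have a finitely additive limit; since the value functions [g m] approximating [v]
   have lower semicontinuous correctors, [v - g m] would have mean at least [e]
   under that limit for every [m].  Finitely additive measures satisfy a Fatou
   inequality for functions with compact superlevel sets, so [v - g m] would not tend to
   [0] at some point of [Y].  The value iterates are only lower semicontinuous; a
   Dini argument replaces them by continuous minorants.

   The inequality [d* <= v] follows by integrating the dual constraints along
   the dynamic programming recursion. *)

Require Import Defs.
From HB Require Import structures.
From mathcomp Require Import all_boot all_order all_algebra.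
From mathcomp Require Import all_classical all_reals all_analysis.
From mathcomp Require Import measurable_realfun ring lra.

Set Implicit Arguments.
Unset Strict Implicit.
Unset Printing Implicit Defensive.

Import Order.TTheory GRing.Theory Num.Theory.
Import numFieldNormedType.Exports.

Local Open Scope classical_set_scope.
Local Open Scope ring_scope.

(** * Sequential compactness and continuity *)

(** With [psi = v] and [mu = v y0 - e] the terms [v y0] cancel in the first dual constraint, so one
    [eta] serves every [y0]. The obstacle is that [g m] tends to [v] only pointwise. What saves the
    argument is that [v - g m] is upper semicontinuous: weak limits of occupation measures can only
    raise its mean, and dominated convergence would then conclude. The Fatou inequality performs
    both steps without representing the limit by a measure. Correctors satisfy [transition (g m) +
    eta m <= k + transition (eta m)]. For averages, [g m] is the normalised value over [m.+1] stages
    and [eta m] the mean of the value iterates. For discounting, [eta m] is a truncated discounted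
    value, and [g m] is that value times the discount rate, minus a truncation error. Since [U] is
    only upper semicontinuous, value iterates are merely lower semicontinuous. Measurability,
    freezing and limits are therefore proved for continuous functions and carried over by increasing
    Lipschitz envelopes. *)

Section sequential_topology.
Context {R : realType}.

(** Subsequences are encoded by [n <= phi n] alone: this suffices for limits and is stable under
    composition and shifts. *)
Definition seq_compact (T : topologicalType) (K : set T) :=
  forall x : nat -> T, (forall n, K (x n)) -> exists l, K l /\
    exists phi : nat -> nat, (forall n, (n <= phi n)%N) /\
      x (phi n) @[n --> \oo] --> l.

Lemma cvg_subseq (T : topologicalType) (x : nat -> T) (l : T) (phi : nat -> nat) :
  (forall n, (n <= phi n)%N) -> x n @[n --> \oo] --> l ->
  x (phi n) @[n --> \oo] --> l.
Proof.
move=> phin xl A /xl [N _ NA]; exists N => // n /= Nn.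
exact/NA/(leq_trans Nn).
Qed.

Lemma cvg_from_inv (T : pseudoMetricType R) (x : nat -> T) (l : T) :
  (forall n, ball l n.+1%:R^-1 (x n)) -> x n @[n --> \oo] --> l.
Proof.
move=> xl; apply/cvg_ballP => e e0.
have [N _ Ne] := near_infty_natSinv_lt (PosNum e0).
by exists N => // n /= Nn; apply: (le_ball _ (xl n)); exact/ltW/Ne.
Qed.

Lemma compact_seq_compact (T : pseudoMetricType R) (K : set T) :
  compact K -> seq_compact K.
Proof.
move=> cK x Kx; have FK : (x @ \oo) K by exists 0%N => //= n _; exact: Kx.
have [l [Kl cl]] := cK _ _ FK; exists l; split => //.
have ex n : exists m, (n <= m)%N /\ ball l n.+1%:R^-1 (x m).
  have xN : (x @ \oo) [set x m | m in [set m | (n <= m)%N]].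
    by exists n => // m /= nm; exists m.
  have [|_ [[m /= nm <-] ?]] := cl _ _ xN (nbhsx_ballx l n.+1%:R^-1 _).
    by rewrite invr_gt0 ltr0n.
  by exists m.
have [phi phiP] := choice ex; exists phi; split; first by move=> n; case: (phiP n).
by apply: cvg_from_inv => n; case: (phiP n).
Qed.

Lemma within_continuous_seq (T Z : topologicalType) (A : set T) (h : T -> Z) :
  {within A, continuous h} -> forall x l, (forall n : nat, A (x n)) -> A l ->
  x n @[n --> \oo] --> l -> h (x n) @[n --> \oo] --> h l.
Proof.
move=> /subspace_continuousP ch x l Ax Al xl B hB.
have [N _ NB] := xl _ (ch l Al B hB); exists N => // n /= Nn; exact: NB.
Qed.

Lemma seq_within_continuous (T Z : pseudoMetricType R) (A : set T) (h : T -> Z) :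
  (forall x l, (forall n : nat, A (x n)) -> A l ->
    x n @[n --> \oo] --> l -> h (x n) @[n --> \oo] --> h l) ->
  {within A, continuous h}.
Proof.
move=> hs; apply/subspace_continuousP => l Al; apply: contrapT => nh.
have [e e0 he] : exists2 e : R, 0 < e &
    ~ \forall x \near within A (nbhs l), ball (h l) e (h x).
  apply: contrapT => /forall2NP H; apply: nh; apply/cvg_ballP => e e0.
  by have [|/contrapT] := H e.
have ex n : exists x, [/\ A x, ball l n.+1%:R^-1 x & ~ ball (h l) e (h x)].
  apply: contrapT => H; apply: he; rewrite /within /= near_withinE.
  near=> x => Ax; apply: contrapT => nb; apply: H; exists x; split => //.
  near: x; apply: nbhsx_ballx; by rewrite invr_gt0 ltr0n.
have [x xP] := choice ex.
have xl : x n @[n --> \oo] --> l by apply: cvg_from_inv => n; case: (xP n).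
have /hs/(_ Al xl)/cvg_ballP/(_ e e0)[N _ /(_ N (leqnn _)) /=] : forall n, A (x n).
  by move=> n; case: (xP n).
by case: (xP N).
Unshelve. all: by end_near. Qed.

Lemma seq_closed (T : pseudoMetricType R) (A : set T) :
  (forall x l, (forall n : nat, A (x n)) -> x n @[n --> \oo] --> l -> A l) ->
  closed A.
Proof.
move=> As l cl.
have ex n : exists x, A x /\ ball l n.+1%:R^-1 x.
  by have := cl _ (nbhsx_ballx l n.+1%:R^-1 _); apply; rewrite invr_gt0 ltr0n.
have [x xP] := choice ex; apply: (As x); first by move=> n; case: (xP n).
by apply: cvg_from_inv => n; case: (xP n).
Qed.

Lemma closed_seq (T : topologicalType) (A : set T) (x : nat -> T) (l : T) :
  closed A -> (forall n, A (x n)) -> x n @[n --> \oo] --> l -> A l.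
Proof.
move=> cA Ax xl; apply: (closed_cvg A cA _ l xl); exact: nearW.
Qed.

(* The indices of the nested family range along a subsequence, whence monotonicity
   in the strong form [m <= n]. *)
Lemma seq_compact_nested (T : topologicalType) (K : nat -> set T) :
  seq_compact (K 0%N) ->
  (forall n x l, (forall m, K n (x m)) -> x m @[m --> \oo] --> l -> K n l) ->
  (forall m n, (m <= n)%N -> K n `<=` K m) ->
  (forall n, K n !=set0) -> exists l, forall n, K n l.
Proof.
move=> c0 cK mK K0; have [x xK] := choice K0.
have [|l [_ [phi [phin xl]]]] := c0 x; first by move=> n; exact: mK (xK n).
exists l => n; apply: (cK n (fun m => x (phi (m + n)%N))).
  by move=> m; apply: mK (xK _); rewrite (leq_trans _ (phin _))// leq_addl.
exact: (cvg_subseq (fun m => leq_addr n m) xl).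
Qed.

Lemma cvg_le_cst (x : nat -> R) (l c : R) :
  x n @[n --> \oo] --> l -> (forall n, x n <= c) -> l <= c.
Proof. by move=> xl xc; apply: (@closed_seq _ [set y | y <= c] x l) => //; exact: closed_le. Qed.

Lemma cvg_ge_cst (x : nat -> R) (l c : R) :
  x n @[n --> \oo] --> l -> (forall n, c <= x n) -> c <= l.
Proof. by move=> xl xc; apply: (@closed_seq _ [set y | c <= y] x l) => //; exact: closed_ge. Qed.

Lemma cvg_le_seq (x x' : nat -> R) (l l' : R) :
  x n @[n --> \oo] --> l -> x' n @[n --> \oo] --> l' ->
  (forall n, x n <= x' n) -> l <= l'.
Proof.
move=> xl xl' xx'; rewrite -subr_ge0; apply: (@cvg_ge_cst (fun n => x' n - x n)).
  exact: cvgB.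
by move=> n; rewrite subr_ge0.
Qed.

(** Near-covering compactness is applied to the filter of finite lists ordered by inclusion.
    Interiors supply the open sets that measurability arguments need. *)
Lemma compact_finite_net (T : pseudoMetricType R) (K : set T) (e : R) :
  compact K -> 0 < e ->
  exists2 l : seq T, {in l, forall a, K a} &
    forall x, K x -> exists2 a, a \in l & (ball a e)° x.
Proof.
move=> cK e0.
pose D := [set l : seq T | {in l, forall a, K a}].
pose F := filter_from D (fun l => [set l' : seq T | {subset l <= l'} /\ D l']).
have FF : Filter F.
  apply: filter_from_filter; first by exists [::].
  move=> l l' Dl Dl'; exists (l ++ l').
    by move=> a; rewrite mem_cat => /orP[/Dl|/Dl'].
  move=> m /= [lm Dm]; split; split => // a al; apply: lm.
    by rewrite mem_cat al.
  by rewrite mem_cat al orbT.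
have /compact_near_coveringP ncK := cK.
have /ncK : forall x, K x -> \forall x' \near x & l \near F,
    exists2 a, a \in l & (ball a e)° x'.
  move=> x Kx; exists ((ball x e)°, [set l' : seq T | {subset [:: x] <= l'} /\ D l']).
    split => /=; first exact: nbhs_interior (nbhsx_ballx x e e0).
    by exists [:: x] => // a; rewrite inE => /eqP ->.
  by case=> x' l /= [xx' [xl _]]; exists x => //; apply: xl; rewrite mem_head.
by move=> [l Dl H]; exists l; [exact: Dl|apply: (H l); split].
Qed.

End sequential_topology.

(** * Measurable selection of minimisers *)

Section sigma_algebra_sets.
Context (T : Type) (G : set (set T)).
Hypothesis sG : sigma_algebra setT G.

Lemma sigma_algebra_setC A : G A -> G (~` A).
Proof. by case: sG => _ + _ GA => /(_ _ GA); rewrite setTD. Qed.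

Lemma sigma_algebra_bigcup (F : nat -> set T) :
  (forall n, G (F n)) -> G (\bigcup_n F n).
Proof. by case: sG => _ _; apply. Qed.

Lemma sigma_algebra_bigcap_nat (F : nat -> set T) :
  (forall n, G (F n)) -> G (\bigcap_n F n).
Proof.
move=> GF; rewrite -[X in G X]setCK setC_bigcap; apply: sigma_algebra_setC.
by apply: sigma_algebra_bigcup => n; exact: sigma_algebra_setC.
Qed.

Lemma sigma_algebra_setU A B : G A -> G B -> G (A `|` B).
Proof.
move=> GA GB; rewrite -bigcup2E; apply: sigma_algebra_bigcup => -[|[|n]] //=.
by case: sG.
Qed.

Lemma sigma_algebra_setI A B : G A -> G B -> G (A `&` B).
Proof.
move=> GA GB; rewrite -[X in G X]setCK setCI; apply: sigma_algebra_setC.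
by apply: sigma_algebra_setU; exact: sigma_algebra_setC.
Qed.

Lemma sigma_algebra_bigcup_seq (I : eqType) (l : seq I) (F : I -> set T) :
  (forall i, i \in l -> G (F i)) -> G (\bigcup_(i in [set` l]) F i).
Proof.
elim: l => [|i l IH] Fl; first by rewrite set_nil bigcup_set0; case: sG.
rewrite (_ : [set` i :: l] = [set i] `|` [set` l]); last first.
  apply/seteqP; split => j /=; rewrite in_cons; first by case/predU1P; [left|right].
  by case=> [->|->]; rewrite ?eqxx ?orbT.
rewrite bigcup_setU bigcup_set1; apply: sigma_algebra_setU.
  by apply: Fl; rewrite mem_head.
by apply: IH => j jl; apply: Fl; rewrite in_cons jl orbT.
Qed.

End sigma_algebra_sets.

Section borel_sets.
Context {T : topologicalType}.

Lemma borel_sigma_algebra : sigma_algebra setT (@borel T).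
Proof. exact: smallest_sigma_algebra. Qed.

Lemma open_borel (A : set T) : open A -> borel A.
Proof. exact: sub_sigma_algebra. Qed.

Lemma closed_borel (A : set T) : closed A -> borel A.
Proof.
move=> /closed_openC/open_borel/(sigma_algebra_setC borel_sigma_algebra).
by rewrite setCK.
Qed.

Lemma borel_ind (G : set (set T)) :
  sigma_algebra setT G -> (forall A, open A -> G A) -> forall B, borel B -> G B.
Proof. by move=> sG oG B; apply; split. Qed.

(** The good-sets principle, relative to [D] because selectors are controlled on [Y] only. *)
Lemma sigma_algebra_preimage_trace (O : Type) (H : set (set O)) (D : set O)
  (x : O -> T) : sigma_algebra setT H -> H D ->
  sigma_algebra setT [set B | H (D `&` x @^-1` B)].
Proof.
move=> sH HD; split.
- by rewrite /= preimage_set0 setI0; case: sH.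
- move=> A /= HA; rewrite setTD.
  have -> : D `&` x @^-1` (~` A) = D `&` ~` (D `&` x @^-1` A).
    by rewrite preimage_setC setCI setIUr setICr set0U.
  by apply: (sigma_algebra_setI sH) => //; exact: sigma_algebra_setC.
- move=> F /= HF; rewrite preimage_bigcup setI_bigcupr.
  exact: sigma_algebra_bigcup.
Qed.

End borel_sets.

Section minima.
Context {R : realType}.

Definition argmin_set (T : Type) (A : set T) (phi : T -> R) : set T :=
  [set u | A u /\ forall u', A u' -> phi u <= phi u'].

Lemma seq_compact_le (T : topologicalType) (K : set T) (phi : T -> R) (a : R) :
  seq_compact K ->
  (forall x l c, (forall n : nat, K (x n)) -> K l -> (forall n, phi (x n) <= c) ->
     x n @[n --> \oo] --> l -> phi l <= c) ->
  (forall n : nat, exists2 x, K x & phi x <= a + n.+1%:R^-1) ->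
  exists2 x, K x & phi x <= a.
Proof.
move=> cK lphi ex.
have /choice[x xP] n : exists x, K x /\ phi x <= a + n.+1%:R^-1.
  by have [x] := ex n; exists x.
have [|l [Kl [f [fn xl]]]] := cK x; first by move=> n; case: (xP n).
exists l => //; apply/ler_addgt0Pl => e e0.
have [N _ Ne] := near_infty_natSinv_lt (PosNum e0).
apply: (lphi (fun n => x (f (n + N)%N)) l) => //.
- by move=> n; case: (xP (f (n + N)%N)).
- move=> n; case: (xP (f (n + N)%N)) => _ /le_trans; apply.
  rewrite addrC lerD2r ltW//; apply: Ne => /=.
  by rewrite (leq_trans _ (fn _))// leq_addl.
- exact: (cvg_subseq (fun m => leq_addr N m) xl).
Qed.

Lemma seq_lsc_min (T : topologicalType) (K : set T) (phi : T -> R) (m : R) :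
  seq_compact K -> K !=set0 -> (forall x, K x -> m <= phi x) ->
  (forall x l c, (forall n : nat, K (x n)) -> K l -> (forall n, phi (x n) <= c) ->
     x n @[n --> \oo] --> l -> phi l <= c) ->
  argmin_set K phi !=set0.
Proof.
move=> cK [x0 Kx0] lb lphi.
pose D := [set phi x | x in K].
have hD : has_inf D.
  by split; [exists (phi x0), x0|exists m => _ [x Kx <-]; exact: lb].
have [n|x Kx xle] := seq_compact_le (a := inf D) cK lphi.
  have n0 : 0 < n.+1%:R^-1 :> R by rewrite invr_gt0 ltr0n.
  by have [_ [x Kx <-] /ltW ?] := inf_adherent n0 hD; exists x.
exists x; split => // u Ku; apply: (le_trans xle).
by apply: ge_inf; [case: hD|exists u].
Qed.

End minima.

Section measurable_selection.
Context {R : realType} {X : topologicalType} {V : metricType R}.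
Variables (Y : set X).
Hypotheses (Y_borel : borel Y) (V_compact : compact [set: V]).

Let borelS := @borel_sigma_algebra X.

(** Measurability of a multifunction is expressed by the lower inverses of closed sets. *)
Definition measurable_correspondence (G : X -> set V) :=
  [/\ forall y, Y y -> G y !=set0,
      forall y, Y y -> forall u l, (forall n : nat, G y (u n)) ->
        u n @[n --> \oo] --> l -> G y l &
      forall C, closed C -> borel (Y `&` [set y | exists u, G y u /\ C u])].

Lemma seq_compact_section (G : set V) :
  (forall u l, (forall n : nat, G (u n)) -> u n @[n --> \oo] --> l -> G l) ->
  seq_compact G.
Proof.
move=> cG x Gx; have [l [_ [phi [phin xl]]]] := compact_seq_compact V_compact (fun n => I : [set: V] (x n)).
by exists l; split; [exact: cG xl|exists phi].
Qed.

(** The minimisers meet [C] exactly when, for every rational [q], a point of [G y] of value at most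
    [q] forces such a point in [C] as well. This turns the comparison of two minima into countably
    many sublevel conditions. *)
Lemma measurable_argmin (G : X -> set V) (phi : X -> V -> R) (m : R) :
  (forall y, Y y -> G y !=set0) ->
  (forall y, Y y -> forall u l, (forall n : nat, G y (u n)) ->
        u n @[n --> \oo] --> l -> G y l) ->
  (forall y, Y y -> forall u l c, (forall n : nat, G y (u n)) -> G y l ->
     (forall n, phi y (u n) <= c) -> u n @[n --> \oo] --> l -> phi y l <= c) ->
  (forall y u, Y y -> G y u -> m <= phi y u) ->
  (forall C r, closed C ->
     borel (Y `&` [set y | exists u, [/\ G y u, C u & phi y u <= r]])) ->
  measurable_correspondence (fun y => argmin_set (G y) (phi y)).
Proof.
move=> G0 Gcl lphi lb mphi.
have cG y : Y y -> seq_compact (G y) by move=> Yy; exact/seq_compact_section/Gcl.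
have amin y : Y y -> argmin_set (G y) (phi y) !=set0.
  move=> Yy; apply: (seq_lsc_min (m := m)) => //; [exact: cG|exact: G0| |exact: lphi].
  by move=> u; exact: lb.
split => // [y Yy u l ul cul|C cC].
  have Gl : G y l by apply: Gcl cul => // n; case: (ul n).
  split => // u' Gu'; apply: (lphi y Yy u l) => // n; first by case: (ul n).
  by case: (ul n) => _; exact.
(* An enumeration of the rationals; indices that decode to nothing merely repeat 0. *)
pose r n : rat := odflt 0 (unpickle n).
pose B D q := Y `&` [set y | exists u, [/\ G y u, D u & phi y u <= ratr q]].
rewrite [X in borel X](_ : _ = Y `&`
    \bigcap_n (~` B setT (r n) `|` B C (r n))); last first.
  apply/seteqP; split => y [Yy].
    move=> [u [[Gu mu] Cu]]; split => // n _.
    have [u'|nu] := pselect (B setT (r n) y); last by left.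
    by right; split => //; exists u; split => //; case: u' => _ [u' [Gu' _]]; exact/le_trans/mu.
  move=> /= H; split => //.
  have [u1 [Gu1 mu1]] := amin y Yy.
  have [||n|u [Gu Cu] ule] := @seq_compact_le R _ (G y `&` C) (phi y) (phi y u1).
  - apply: seq_compact_section => u l GCu ul; split.
      by apply: Gcl ul => // k; case: (GCu k).
    by apply: (closed_seq cC _ ul) => k; case: (GCu k).
  - move=> x l c Kx [Gl _] xc xl; apply: (lphi y Yy x l) => // k; by case: (Kx k).
  - have y1 : phi y u1 < phi y u1 + n.+1%:R^-1.
      by rewrite ltrDl invr_gt0 ltr0n.
    have [q] := rat_in_itvoo y1; rewrite in_itv /= => /andP[q1 q2].
    have [|[_ [u [Gu Cu uq]]]] := H (pickle q) Logic.I.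
      rewrite /r pickleK /= => nB; exfalso; apply: nB; split => //; exists u1; split => //; exact: ltW.
    exists u => //; move: uq; rewrite /r pickleK /= => /le_trans; apply; exact: ltW.
  - exists u; split => //; split => // u' Gu'; exact: le_trans ule (mu1 _ Gu').
have mB D n : closed D -> borel (B D (r n)) by move=> cD; exact: mphi.
apply: (sigma_algebra_setI borelS) => //; apply: (sigma_algebra_bigcap_nat borelS) => n.
apply: (sigma_algebra_setU borelS); last exact: mB.
by apply: (sigma_algebra_setC borelS); apply: mB; exact: closedT.
Qed.

Lemma compact_dense_seq (u0 : V) :
  exists q : nat -> V, forall v (e : R), 0 < e -> exists i, mdist (q i) v < e.
Proof.
have net m : exists l : seq V, forall v, exists2 a, a \in l & mdist a v < m.+1%:R^-1.
  have [|l _ Hl] := compact_finite_net (e := m.+1%:R^-1) V_compact.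
    by rewrite invr_gt0 ltr0n.
  exists l => v; have [//|a al /interior_subset] := Hl v.
  by rewrite ballEmdist /= => ?; exists a.
have [l lP] := choice net.
exists (fun n => let p : nat * nat := odflt (0, 0)%N (unpickle n) in nth u0 (l p.1) p.2).
move=> v e e0; have [N _ Ne] := near_infty_natSinv_lt (PosNum e0).
have [a al av] := lP N v; exists (pickle (N, index a (l N))).
by rewrite pickleK /= nth_index// (lt_trans av)//; apply: Ne => /=.
Qed.

Variables (U : X -> set V) (h : X -> V -> R) (m : R) (u0 : V).
Hypotheses (U0 : forall y, Y y -> U y !=set0)
  (Ucl : forall y, Y y -> forall u l, (forall n : nat, U y (u n)) ->
        u n @[n --> \oo] --> l -> U y l)
  (h_lsc : forall y, Y y -> forall u l c, (forall n : nat, U y (u n)) -> U y l ->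
     (forall n, h y (u n) <= c) -> u n @[n --> \oo] --> l -> h y l <= c)
  (h_lb : forall y u, Y y -> U y u -> m <= h y u)
  (h_borel : forall C r, closed C ->
     borel (Y `&` [set y | exists u, [/\ U y u, C u & h y u <= r]])).

Lemma mdist_lsc (a : V) (u : nat -> V) (l : V) (c : R) :
  u n @[n --> \oo] --> l -> (forall n, mdist a (u n) <= c) -> mdist a l <= c.
Proof.
move=> ul uc; apply/ler_addgt0Pl => e e0.
have /cvg_ballP/(_ e e0)[N _ /(_ N (leqnn _)) /=] := ul.
rewrite ballEmdist /= => uNl.
apply: le_trans (metric_triangle a (u N) l) _.
by rewrite addrC lerD// metric_sym ltW.
Qed.

(* Ties between minimisers are broken by minimising in turn the distances to a
   dense sequence; this leaves a single point. *)
Theorem measurable_minimizer : exists sg : X -> V,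
  (forall y, Y y -> argmin_set (U y) (h y) (sg y)) /\
  (forall B, borel B -> borel (Y `&` sg @^-1` B)).
Proof.
have [q qP] := compact_dense_seq u0.
pose G := fix G n := if n is k.+1 then
  (fun y => argmin_set (G k y) (mdist (q k))) else fun y => argmin_set (U y) (h y).
have mG n : measurable_correspondence (G n).
  elim: n => [|n [Gn0 Gncl Gnm]] /=; first exact: (measurable_argmin (m := m)).
  apply: (measurable_argmin (phi := fun _ => mdist (q n)) (m := 0)) => //.
  - by move=> y Yy u l c _ _ uc ul; exact: mdist_lsc uc.
  - by move=> y u _ _; exact: mdist_ge0.
  move=> C r cC; have /Gnm : closed (C `&` [set u | mdist (q n) u <= r]).
    apply: closedI => //; apply: seq_closed => u l ul cul.
    exact: mdist_lsc ul.
  by congr borel; congr (_ `&` _); apply/seteqP; split => y [u];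
    [move=> [? []]|move=> []]; exists u.
have Gsub i j y : (i <= j)%N -> G j y `<=` G i y.
  move=> /subnK <-; elim: (j - i)%N => // k IH u; rewrite addSn /= => -[].
  by move=> ? _; exact: IH.
have nest y (C : set V) : Y y -> closed C -> (forall n, exists u, G n y u /\ C u) ->
    exists u, forall n, G n y u /\ C u.
  move=> Yy cC GC.
  have GCcl n x l : (forall k : nat, (G n y `&` C) (x k)) ->
      x k @[k --> \oo] --> l -> (G n y `&` C) l.
    move=> GCx xl; have [_ Gcl _] := mG n; split.
      by apply: Gcl xl => // k; case: (GCx k).
    by apply: (closed_seq cC _ xl) => k; case: (GCx k).
  apply: (seq_compact_nested (K := fun n => G n y `&` C)) => //.
  - by apply: seq_compact_section => x l; exact: GCcl.
  - by move=> i j ij u [Gu Cu]; split => //; exact: Gsub ij _ Gu.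
have ex y : exists u, Y y -> forall n, G n y u.
  have [Yy|nYy] := pselect (Y y); last by exists u0.
  have [n|u uP] := nest y setT Yy closedT; last by exists u => _ n; case: (uP n).
  by have [/(_ y Yy)[u Gu] _ _] := mG n; exists u.
have [sg sgP] := choice ex; exists sg; split.
  by move=> y Yy; exact: (sgP y Yy 0%N).
(* [sg y] is no farther from [q i] than [u] is, so taking [q i] close to [u] forces the two points
   together. *)
have uniq y u : Y y -> (forall n, G n y u) -> sg y = u.
  move=> Yy Gu; apply: mdist_positivity; apply/eqP; rewrite eq_le mdist_ge0 andbT.
  apply/ler_addgt0Pl => e e0; rewrite addr0.
  have [i] := qP u (e / 2) (divr_gt0 e0 (ltr0Sn _ 1)) => qu.
  have qs : mdist (q i) (sg y) <= mdist (q i) u.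
    by have [_] := sgP y Yy i.+1; apply; exact: Gu.
  apply: le_trans (metric_triangle _ (q i) _) _.
  rewrite (splitr e) metric_sym lerD//; [exact: le_trans qs (ltW qu)|exact: ltW].
apply: borel_ind; first exact: sigma_algebra_preimage_trace.
move=> A oA.
have -> : Y `&` sg @^-1` A = Y `&` ~` (Y `&` sg @^-1` (~` A)).
  by rewrite preimage_setC setCI setIUr setICr set0U setCK.
apply: (sigma_algebra_setI borelS) => //; apply: (sigma_algebra_setC borelS).
have cA : closed (~` A) by exact: open_closedC.
(* By nested compactness, a closed set that meets every [G n y] meets their intersection, which is
   the single point [sg y]. *)
rewrite (_ : _ `&` _ = \bigcap_n (Y `&` [set y | exists u, G n y u /\ (~` A) u])).
  by apply: (sigma_algebra_bigcap_nat borelS) => n; have [_ _] := mG n; exact.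
apply/seteqP; split => y.
  by move=> [Yy nA] n _; split => //; exists (sg y); split => //; exact: sgP.
move=> H; have [Yy _] := H 0%N Logic.I; split => //.
have [n|u uP] := nest y (~` A) Yy cA; first by have [] := H n Logic.I.
by rewrite /preimage /= (uniq y u Yy) => [|n]; [case: (uP 0%N)|case: (uP n)].
Qed.

End measurable_selection.

(** * Expectation of bounded random variables *)

Section bounded_expectation.
Context d (Om : measurableType d) (R : realType) (P : probability Om R).

Definition bounded_rv (Z : Om -> R) :=
  measurable_fun setT Z /\ exists M, forall w, `|Z w| <= M.

Definition Ex (Z : Om -> R) : R := (\int[P]_w Z w)%R.

Lemma bounded_rv_integrable Z : bounded_rv Z -> P.-integrable setT (EFin \o Z).
Proof.
move=> [mZ [M ZM]]; apply: measurable_bounded_integrable => //.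
  by rewrite -ge0_fin_numE// fin_num_measure.
by exists M; split; [exact: num_real|move=> x Mx w _; exact: le_trans (ZM w) (ltW Mx)].
Qed.

Lemma expectationE Z : bounded_rv Z -> 'E_P[Z]%E = (Ex Z)%:E.
Proof.
move=> bZ; rewrite unlock /Ex /Rintegral fineK//.
exact: integrable_fin_num (bounded_rv_integrable bZ).
Qed.

Lemma bounded_rv_cst c : bounded_rv (fun=> c).
Proof. by split; [exact: measurable_cst|exists `|c|]. Qed.

Lemma bounded_rvD Z Z' : bounded_rv Z -> bounded_rv Z' ->
  bounded_rv (fun w => Z w + Z' w).
Proof.
move=> [mZ [M ZM]] [mZ' [M' ZM']]; split; first exact: measurable_funD.
by exists (M + M') => w; rewrite (le_trans (ler_normD _ _))// lerD.
Qed.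

Lemma bounded_rvM Z Z' : bounded_rv Z -> bounded_rv Z' ->
  bounded_rv (fun w => Z w * Z' w).
Proof.
move=> [mZ [M ZM]] [mZ' [M' ZM']]; split; first exact: measurable_funM.
by exists (M * M') => w; rewrite normrM ler_pM.
Qed.

Lemma bounded_rvZ c Z : bounded_rv Z -> bounded_rv (fun w => c * Z w).
Proof. by move=> bZ; apply: bounded_rvM => //; exact: bounded_rv_cst. Qed.

Lemma bounded_rvB Z Z' : bounded_rv Z -> bounded_rv Z' ->
  bounded_rv (fun w => Z w - Z' w).
Proof.
move=> [mZ [M ZM]] [mZ' [M' ZM']]; split; first exact: measurable_funB.
by exists (M + M') => w; rewrite (le_trans (ler_normB _ _))// lerD.
Qed.

Lemma bounded_rv_max Z Z' : bounded_rv Z -> bounded_rv Z' ->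
  bounded_rv (fun w => Num.max (Z w) (Z' w)).
Proof.
move=> [mZ [M ZM]] [mZ' [M' ZM']]; split; first exact: measurable_maxr.
exists (Num.max M M') => w; rewrite le_max; case: (leP (Z w)) => _.
  by rewrite ZM' orbT.
by rewrite ZM.
Qed.

Lemma bounded_rv_indic (A : set Om) : measurable A -> bounded_rv (\1_A).
Proof.
move=> mA; split; first exact: measurable_indic.
by exists 1 => w; rewrite indicE; case: (_ \in _); rewrite ?normr1 ?normr0.
Qed.

Lemma bounded_rv_sum (I : Type) (l : seq I) (Z : I -> Om -> R) :
  (forall i, bounded_rv (Z i)) -> bounded_rv (fun w => \sum_(i <- l) Z i w).
Proof.
move=> bZ; elim: l => [|i l IH].
  by under eq_fun do rewrite big_nil; exact: bounded_rv_cst.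
by under eq_fun do rewrite big_cons; exact: bounded_rvD.
Qed.

Lemma Ex_cst c : Ex (fun=> c) = c.
Proof. rewrite /Ex Rintegral_cst//= (_ : P _ = 1%E) ?mulr1//.
exact: probability_setT. Qed.

Lemma ExD Z Z' : bounded_rv Z -> bounded_rv Z' ->
  Ex (fun w => Z w + Z' w) = Ex Z + Ex Z'.
Proof. by move=> bZ bZ'; rewrite /Ex RintegralD//; exact: bounded_rv_integrable. Qed.

Lemma ExB Z Z' : bounded_rv Z -> bounded_rv Z' ->
  Ex (fun w => Z w - Z' w) = Ex Z - Ex Z'.
Proof. by move=> bZ bZ'; rewrite /Ex RintegralB//; exact: bounded_rv_integrable. Qed.

Lemma ExZ c Z : bounded_rv Z -> Ex (fun w => c * Z w) = c * Ex Z.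
Proof. by move=> bZ; rewrite /Ex RintegralZl//; exact: bounded_rv_integrable. Qed.

Lemma Ex_affine a c Z Z' : bounded_rv Z -> bounded_rv Z' ->
  Ex (fun w => a * Z w + Z' w + c) = a * Ex Z + Ex Z' + c.
Proof.
move=> bZ bZ'; have baZ := bounded_rvZ a bZ.
rewrite ExD ?Ex_cst; [|exact: bounded_rvD|exact: bounded_rv_cst].
by rewrite ExD// ExZ.
Qed.

Lemma Ex_sum (I : Type) (l : seq I) (Z : I -> Om -> R) :
  (forall i, bounded_rv (Z i)) ->
  Ex (fun w => \sum_(i <- l) Z i w) = \sum_(i <- l) Ex (Z i).
Proof.
move=> bZ; elim: l => [|i l IH].
  by under eq_fun do rewrite big_nil; rewrite big_nil Ex_cst.
under eq_fun do rewrite big_cons.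
by rewrite big_cons ExD// ?IH//; exact: bounded_rv_sum.
Qed.

Lemma Ex_le Z Z' : bounded_rv Z -> bounded_rv Z' -> (forall w, Z w <= Z' w) ->
  Ex Z <= Ex Z'.
Proof.
move=> bZ bZ' ZZ'; apply: le_Rintegral => //; exact: bounded_rv_integrable.
Qed.

Lemma Ex_norm_le Z (M : R) : bounded_rv Z -> (forall w, `|Z w| <= M) -> `|Ex Z| <= M.
Proof.
move=> bZ ZM; rewrite ler_norml -[X in X <= _](Ex_cst (- M)) -[X in _ && (_ <= X)](Ex_cst M).
apply/andP; split; apply: Ex_le => //; do ?exact: bounded_rv_cst.
- by move=> w; have := ZM w; rewrite ler_norml => /andP[].
- by move=> w; have := ZM w; rewrite ler_norml => /andP[].
Qed.

Lemma Ex_indic (A : set Om) : measurable A -> Ex (\1_A) = fine (P A).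
Proof. by move=> mA; rewrite /Ex /Rintegral integral_indic// setIT. Qed.

Lemma bounded_rv_cvg (Z : nat -> Om -> R) (L : Om -> R) (M : R) :
  (forall n, measurable_fun setT (Z n)) -> (forall n w, `|Z n w| <= M) ->
  (forall w, Z n w @[n --> \oo] --> L w) -> bounded_rv L.
Proof.
move=> mZ ZM ZL; split.
  by apply: (measurable_fun_cvg (h := Z)) => // w _; exact: ZL.
exists M => w; have nZ : `|Z n w| @[n --> \oo] --> `|L w| by exact: cvg_norm (ZL w).
exact: cvg_le_cst nZ _.
Qed.

Lemma Ex_cvg (Z : nat -> Om -> R) (L : Om -> R) (M : R) :
  (forall n, measurable_fun setT (Z n)) -> (forall n w, `|Z n w| <= M) ->
  (forall w, Z n w @[n --> \oo] --> L w) -> Ex (Z n) @[n --> \oo] --> Ex L.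
Proof.
move=> mZ ZM ZL.
have bL := bounded_rv_cvg mZ ZM ZL.
have bZ n : bounded_rv (Z n) by split; [|exists M].
have [||||| _ _] := @dominated_convergence _ Om R P setT measurableT
  (fun n w => (Z n w)%:E) (fun w => (L w)%:E) (fun=> M%:E).
- by move=> n; exact/measurable_EFinP.
- by apply/measurable_EFinP; case: bL.
- by apply: aeW => w _; apply/fine_cvgP; split; [exact: nearW|exact: ZL].
- exact: bounded_rv_integrable (bounded_rv_cst M).
- by apply: aeW => w n _; rewrite lee_fin.
have EF Z' : bounded_rv Z' -> (\int[P]_w (Z' w)%:E)%E = (Ex Z')%:E.
  by move=> b; rewrite -expectationE// unlock.
rewrite EF// => /fine_cvg; exact.
Qed.

End bounded_expectation.

(** * Measurability in a sub-sigma-algebra and Caratheodory maps *)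

Section measurability_in_sigma_algebra.
Context (R : realType) (Om : Type) (G : set (set Om)).
Hypothesis sG : sigma_algebra setT G.

(* A sub-sigma-algebra is a plain family of sets, so that several of them live on
   the same type [Om]. *)
Definition measurable_in (T : topologicalType) (z : Om -> T) :=
  forall B, borel B -> G (z @^-1` B).

Lemma measurable_in_open (T : topologicalType) (z : Om -> T) :
  (forall A, open A -> G (z @^-1` A)) -> measurable_in z.
Proof.
move=> oz B bB; have GT : G setT by case: sG => G0 GD _; rewrite -(setD0 setT); exact: GD.
have := sigma_algebra_preimage_trace z sG GT.
move=> /borel_ind/(_ _ B bB) /=; rewrite setTI; apply => A oA.
by rewrite /= setTI; exact: oz.
Qed.

Lemma measurable_in_cst (T : topologicalType) (c : T) : measurable_in (fun=> c).
Proof.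
move=> B _; have [Bc|Bc] := pselect (B c).
  rewrite (_ : _ @^-1` _ = setT); last by apply/seteqP; split.
  by case: sG => G0 GD _; rewrite -(setD0 setT); exact: GD.
rewrite (_ : _ @^-1` _ = set0); last by apply/seteqP; split.
by case: sG.
Qed.

Lemma measurable_in_continuous (T T' : topologicalType) (g : T -> T') (z : Om -> T) :
  continuous g -> measurable_in z -> measurable_in (g \o z).
Proof.
move=> /continuousP cg mz; apply: measurable_in_open => A oA.
by rewrite comp_preimage; apply: mz; apply: open_borel; exact: cg.
Qed.

(** An open [A] is exhausted by the sets of points keeping a ball of radius [k.+1%:R^-1] inside [A];
    the limit is in [A] exactly when the sequence eventually stays in the interior of one of
    them. *)
Lemma measurable_in_cvg (T : pseudoMetricType R) (z : nat -> Om -> T) (l : Om -> T) :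
  (forall n, measurable_in (z n)) -> (forall w, z n w @[n --> \oo] --> l w) ->
  measurable_in l.
Proof.
move=> mz zl; apply: measurable_in_open => A oA.
pose D (k : nat) := [set x : T | ball x k.+1%:R^-1 `<=` A]°.
rewrite (_ : _ @^-1` _ =
    \bigcup_k \bigcup_N \bigcap_n (z (n + N)%N @^-1` D k)); last first.
  apply/seteqP; split => w /=.
    move=> Alw; have /nbhs_ballP[e /= e0 eA] : nbhs (l w) A by exact: open_nbhs_nbhs.
    have e4 : 0 < e / 4 by exact: divr_gt0.
    have [k _ /(_ k (leqnn _)) ke] := near_infty_natSinv_lt (PosNum e4).
    have /cvg_ballP/(_ _ e4)[N _ NP] := zl w.
    exists k => //; exists N => // n _ /=.
    (* From [l w] to the term, to [x], to [y]: three steps of size [e / 4]. *)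
    apply/nbhs_ballP; exists (e / 4) => //= x zx y xy; apply: eA.
    apply: (@le_ball _ _ _ (e / 4 + e / 4 + e / 4)); first by lra.
    apply: ball_triangle (le_ball (ltW ke) xy).
    by apply: ball_triangle zx; apply: NP => /=; rewrite leq_addl.
  move=> [k _ [N _ H]].
  have k0 : 0 < k.+1%:R^-1 :> R by rewrite invr_gt0.
  have /cvg_ballP/(_ _ k0)[N' _ NP] := zl w.
  have := H N' Logic.I => /interior_subset; apply.
  by apply: ball_sym; apply: NP => /=; rewrite leq_addr.
apply: (sigma_algebra_bigcup sG) => k; apply: (sigma_algebra_bigcup sG) => N.
apply: (sigma_algebra_bigcap_nat sG) => n; apply: mz; apply: open_borel.
exact: open_interior.
Qed.

Lemma measurable_in_finite_valued (T : topologicalType) (z : Om -> T) (l : seq T) :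
  (forall w, z w \in l) -> (forall a, G [set w | z w = a]) -> measurable_in z.
Proof.
move=> lP Gz B bB.
rewrite (_ : _ @^-1` _ =
    \bigcup_(a in [set` [seq a <- l | `[< B a >]]]) [set s | z s = a]).
  by apply: (sigma_algebra_bigcup_seq sG) => a _; exact: Gz.
apply/seteqP; split => s /=.
  by move=> Bs; exists (z s) => //=; rewrite mem_filter lP andbT; exact/asboolP.
by move=> [a /=]; rewrite mem_filter => /andP[/asboolP Ba _] ->.
Qed.

(** Each value is sent to the first point of a finite net whose ball contains it in its interior, so
    the level sets are Boolean combinations of preimages of open sets. *)
Lemma finite_valued_approx (T : pseudoMetricType R) (K : set T) (z : Om -> T) :
  compact K -> measurable_in z -> (forall w, K (z w)) ->
  exists z_ : nat -> Om -> T, [/\ forall n w, K (z_ n w),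
    forall n, exists l : seq T, forall w, z_ n w \in l,
    forall n a, G [set w | z_ n w = a] &
    forall w, z_ n w @[n --> \oo] --> z w].
Proof.
move=> cK mz Kz.
suff H e : 0 < e -> exists p : Om -> T, [/\ forall w, K (p w),
    exists l : seq T, forall w, p w \in l, forall a, G [set w | p w = a] &
    forall w, ball (z w) e (p w)].
  have /choice[z_ zP] n : exists p : Om -> T, [/\ forall w, K (p w),
    exists l : seq T, forall w, p w \in l, forall a, G [set w | p w = a] &
    forall w, ball (z w) n.+1%:R^-1 (p w)] by apply: H; rewrite invr_gt0.
  exists z_; split; do ?by move=> n; case: (zP n).
  by move=> w; apply: cvg_from_inv => n; case: (zP n).
(* [pick] falls back on the value [z w0], so an empty [Om] is set apart. *)
move=> e0; have [[w0 _]|nOm] := pselect (exists w : Om, True); last first.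
  have Om0 : Om -> False by move=> w; apply: nOm; exists w.
  exists z; split; [by []|by exists [::] => w; have := Om0 w| |by move=> w; have := Om0 w].
  move=> a; rewrite (_ : [set w | _] = set0); first by case: sG.
  by apply/seteqP; split => // w; have := Om0 w.
have [l Kl lP] := compact_finite_net cK e0.
pose near_ a w := `[< (ball a e)° (z w) >].
pose pick := fix pick (l : seq T) w :=
  if l is a :: l' then (if near_ a w then a else pick l' w) else z w0.
have Gnear a : G [set w | near_ a w].
  rewrite (_ : [set w | near_ a w] = z @^-1` (ball a e)°); last first.
    by apply/seteqP; split => w /=; rewrite /near_ => /asboolP.
  by apply: mz; apply: open_borel; exact: open_interior.
have GT : G setT by case: sG => G0 GD _; rewrite -(setD0 setT); exact: GD.
have Gdec (Q : Prop) : G [set w | Q].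
  have [q|q] := pselect Q.
    by rewrite (_ : [set w | Q] = setT)//; apply/seteqP; split.
  by rewrite (_ : [set w | Q] = set0); [case: sG|apply/seteqP; split].
have Gpick l' a : G [set w | pick l' w = a].
  elim: l' => [|b l' IH] /=; first exact: Gdec.
  rewrite (_ : [set w | _] = ([set w | near_ b w] `&` [set w | b = a]) `|`
      (~` [set w | near_ b w] `&` [set w | pick l' w = a])).
    apply: (sigma_algebra_setU sG); apply: (sigma_algebra_setI sG) => //.
    exact: sigma_algebra_setC.
  apply/seteqP; split => w /=; first by case: ifPn => [nb|/negP nb] H; [left|right].
  by case=> [[-> //]|[/negP/negbTE ->]].
have pickP l' w : (exists2 a, a \in l' & near_ a w) ->
    pick l' w \in l' /\ near_ (pick l' w) w.
  elim: l' => [|b l' IH] [a]; first by rewrite in_nil.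
  rewrite in_cons /=; case: ifPn => [nb _ _|nb al na]; first by rewrite in_cons eqxx.
  have [|il nl] := IH; last by rewrite in_cons il orbT.
  by exists a => //; case/predU1P: al => // ab; move: nb; rewrite -ab na.
have ex w : exists2 a, a \in l & near_ a w.
  by have [a al aw] := lP _ (Kz w); exists a => //; exact/asboolP.
exists (pick l); split => //.
- by move=> w; case: (pickP l w (ex w)) => + _; exact: Kl.
- by exists l => w; case: (pickP l w (ex w)).
- move=> w; case: (pickP l w (ex w)) => _ /asboolP /interior_subset.
  exact: ball_sym.
Qed.

Context (X V Z : pseudoMetricType R) (S : topologicalType).
Variables (K : set X) (L : set V) (Phi : X -> V -> S -> Z).
Hypotheses (cK : compact K) (cL : compact L)
  (Phi_cont : forall s (y : nat -> X) (u : nat -> V) y0 u0,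
    (forall n, K (y n)) -> (forall n, L (u n)) -> K y0 -> L u0 ->
    y n @[n --> \oo] --> y0 -> u n @[n --> \oo] --> u0 ->
    Phi (y n) (u n) s @[n --> \oo] --> Phi y0 u0 s)
  (Phi_borel : forall y u, K y -> L u -> forall B, borel B -> borel (Phi y u @^-1` B)).

(** Only [y] and [u] are approximated: on a common level set [Phi] is frozen at a pair and depends
    on [x] alone, and continuity in the pair gives the limit. *)
Lemma measurable_in_caratheodory (y : Om -> X) (u : Om -> V) (x : Om -> S) :
  measurable_in y -> measurable_in u -> measurable_in x ->
  (forall w, K (y w)) -> (forall w, L (u w)) ->
  measurable_in (fun w => Phi (y w) (u w) (x w)).
Proof.
move=> my mu mx Ky Lu.
have [y_ [Ky_ fy Gy yl]] := finite_valued_approx cK my Ky.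
have [u_ [Lu_ fu Gu ul]] := finite_valued_approx cL mu Lu.
apply: (@measurable_in_cvg _ (fun n w => Phi (y_ n w) (u_ n w) (x w))); last first.
  by move=> w; exact: Phi_cont.
move=> n B bB; have [ly lyP] := fy n; have [lu luP] := fu n.
rewrite (_ : _ @^-1` _ = \bigcup_(a in [set` ly]) \bigcup_(b in [set` lu])
   ([set w | y_ n w = a] `&` [set w | u_ n w = b] `&` x @^-1` (Phi a b @^-1` B))).
  apply: (sigma_algebra_bigcup_seq sG) => a aly.
  apply: (sigma_algebra_bigcup_seq sG) => b blu.
  (* The lists may contain points outside [K] and [L]; only values actually taken are known to lie
     there. *)
  have [ab|ab] := pselect ([set w | y_ n w = a] `&` [set w | u_ n w = b] !=set0).
    have [w [/= ya ub]] := ab.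
    do 2?apply: (sigma_algebra_setI sG) => //.
    by apply: mx; apply: Phi_borel => //; [rewrite -ya|rewrite -ub].
  rewrite (_ : [set w | y_ n w = a] `&` [set w | u_ n w = b] = set0); first by rewrite set0I; case: sG.
  by apply/seteqP; split => // w H; apply: ab; exists w.
apply/seteqP; split => w /=.
  by move=> H; exists (y_ n w); [exact: lyP|exists (u_ n w); [exact: luP|]].
by move=> [a _ [b _ [[<- <-]]]].
Qed.

End measurability_in_sigma_algebra.

(** * Independence and freezing *)

Section freezing.
Context d (Om : measurableType d) (R : realType) (P : probability Om R).

Lemma measurable_sigma_algebra : sigma_algebra setT (@measurable _ Om).
Proof.
split => //; first by move=> A mA; exact: measurableD.
by move=> F mF; exact: bigcup_measurable.
Qed.

Lemma measurable_in_fun (G : set (set Om)) (Z : Om -> R) :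
  (forall A, G A -> measurable A) -> measurable_in G Z -> measurable_fun setT Z.
Proof.
move=> Gm mZ; apply: (measurability _ (RGenOpens.measurableE R)).
move=> _ [_ [a [b ->] <-]]; rewrite setTI; apply: Gm; apply: mZ; apply: open_borel.
exact: interval_open.
Qed.

(** The indicators of the level sets sum to one over [undup l]; over [l] a repeated value would
    count twice. *)
Lemma Ex_finite_valued (T : eqType) (p : Om -> T) (l : seq T) (F : T -> Om -> R) :
  (forall w, p w \in l) -> (forall a, measurable [set w | p w = a]) ->
  (forall w, bounded_rv (F (p w))) ->
  Ex P (fun w => F (p w) w) =
  \sum_(a <- undup l) Ex P (fun w => \1_[set w' | p w' = a] w * F a w).
Proof.
move=> pl mp bF; rewrite -Ex_sum; last first.
  move=> a; have [[w /= wa]|na] := pselect (exists w, p w = a).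
    by rewrite -wa; apply: bounded_rvM => //; exact: bounded_rv_indic.
  rewrite (_ : (fun w => _) = fun=> 0); first exact: bounded_rv_cst.
  apply/funext => w; rewrite indicE memNset ?mul0r//= => wa.
  by apply: na; exists w.
congr Ex; apply/funext => w.
rewrite (bigD1_seq (p w)) ?undup_uniq ?mem_undup//= indicE mem_set// mul1r.
rewrite big1 ?addr0// => a aw; rewrite indicE memNset ?mul0r//=.
by move=> wa; rewrite wa eqxx in aw.
Qed.

Context (S : topologicalType) (G : set (set Om)) (x x' : Om -> S).
Hypotheses (sG : sigma_algebra setT G) (Gm : forall A, G A -> measurable A)
  (mx : random_element x) (mx' : random_element x')
  (ind : forall A B, G A -> borel B ->
    P (A `&` x @^-1` B) = (P A * P (x' @^-1` B))%E).

Lemma borel_fun_bounded_rv (Z : S -> R) (z : Om -> S) (M : R) :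
  random_element z -> measurable_in (@borel S) Z -> (forall s, `|Z s| <= M) ->
  bounded_rv (Z \o z).
Proof.
move=> mz bZ ZM; split; last by exists M => w; exact: ZM.
apply: (@measurable_in_fun (@measurable _ Om)) => // B bB.
by rewrite comp_preimage; apply: mz; exact: bZ.
Qed.

(** Independence passes from sets to bounded functions: finite-valued approximations of [Z] keep its
    bound, so bounded convergence applies on both sides. *)
Lemma Ex_indic_indep (A : set Om) (Z : S -> R) (M : R) :
  G A -> measurable_in (@borel S) Z -> (forall s, `|Z s| <= M) ->
  Ex P (fun w => \1_A w * Z (x w)) = Ex P (\1_A) * Ex P (Z \o x').
Proof.
move=> GA bZ ZM.
have ZK s : `[- M, M]%classic (Z s) by rewrite /= in_itv /= -ler_norml.
have [Z_ [ZK_ fZ mZ Zl]] := finite_valued_approx (@borel_sigma_algebra S)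
  (@segment_compact _ (- M) M) bZ ZK.
have ZM_ n s : `|Z_ n s| <= M by have := ZK_ n s; rewrite /= in_itv /= -ler_norml.
have M0 : 0 <= M by apply: le_trans (ZM (x point)).
have mA : measurable A by exact: Gm.
have mz n (z : Om -> S) a : random_element z -> measurable [set w | Z_ n (z w) = a].
  by move=> rz; exact: (rz _ (mZ n a)).
have bZn n (z : Om -> S) : random_element z -> bounded_rv (fun w => Z_ n (z w)).
  move=> rz; apply: (borel_fun_bounded_rv rz _ (ZM_ n)).
  have [l lP] := fZ n.
  exact: (measurable_in_finite_valued (@borel_sigma_algebra S) lP (mZ n)).
have bA : bounded_rv (\1_A : Om -> R) by exact: bounded_rv_indic.
have key n : Ex P (fun w => \1_A w * Z_ n (x w)) = Ex P (\1_A) * Ex P (fun w => Z_ n (x' w)).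
  have [l lP] := fZ n.
  rewrite (@Ex_finite_valued _ (fun w => Z_ n (x w)) l (fun a w => \1_A w * a)) //; first last.
  - by move=> w; apply: bounded_rvM => //; exact: bounded_rv_cst.
  - by move=> a; exact: mz.
  rewrite (@Ex_finite_valued _ (fun w => Z_ n (x' w)) l (fun a w => a)) //; first last.
  - by move=> w; exact: bounded_rv_cst.
  - by move=> a; exact: mz.
  rewrite mulr_sumr; apply: eq_bigr => a _.
  have E1 : (fun w => \1_[set w' | Z_ n (x w') = a] w * (\1_A w * a)) =
      (fun w => a * \1_(A `&` x @^-1` [set s | Z_ n s = a]) w) :> (Om -> R).
    apply/funext => w; rewrite indicI /= mulrA mulrC; congr (_ * _).
    by rewrite mulrC.
  have E2 : (fun w => \1_[set w' | Z_ n (x' w') = a] w * a) =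
      (fun w => a * \1_(x' @^-1` [set s | Z_ n s = a]) w) :> (Om -> R).
    by apply/funext => w; rewrite mulrC.
  have mI : measurable (A `&` x @^-1` [set s | Z_ n s = a]).
    by apply: measurableI => //; exact: mz.
  rewrite E1 E2 !ExZ; try by apply: bounded_rv_indic => //; exact: mz.
  rewrite !Ex_indic//; last exact: mz.
  by rewrite ind// fineM ?fin_num_measure//; [rewrite mulrCA|exact: mz].
have c1 : Ex P (fun w => \1_A w * Z_ n (x w)) @[n --> \oo] -->
    Ex P (fun w => \1_A w * Z (x w)).
  apply: (@Ex_cvg _ _ _ P _ _ M).
  - by move=> n; have [] := bounded_rvM bA (bZn n x mx).
  - move=> n w; rewrite normrM indicE; case: (_ \in _).
      by rewrite normr1 mul1r.
    by rewrite normr0 mul0r.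
  - by move=> w; apply: cvgMr; exact: Zl.
have c2 : Ex P (\1_A) * Ex P (fun w => Z_ n (x' w)) @[n --> \oo] -->
    Ex P (\1_A) * Ex P (Z \o x').
  apply: cvgMr; apply: (@Ex_cvg _ _ _ P _ _ M) => //.
  by move=> n; have [] := bZn n x' mx'.
apply: (cvg_unique _ c1); first exact: Rhausdorff.
by move: c2; under eq_fun do rewrite -key.
Qed.

Context (X V : pseudoMetricType R).
Variables (K : set X) (L : set V) (Phi : X -> V -> S -> R) (M : R).
Hypotheses (cK : compact K) (cL : compact L)
  (Phi_cont : forall s (y : nat -> X) (u : nat -> V) y0 u0,
    (forall n, K (y n)) -> (forall n, L (u n)) -> K y0 -> L u0 ->
    y n @[n --> \oo] --> y0 -> u n @[n --> \oo] --> u0 ->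
    Phi (y n) (u n) s @[n --> \oo] --> Phi y0 u0 s)
  (Phi_borel : forall y u, K y -> L u -> measurable_in (@borel S) (Phi y u))
  (Phi_bounded : forall y u s, K y -> L u -> `|Phi y u s| <= M).

Let q a b := Ex P (Phi a b \o x').

Let bPhi (z : Om -> S) a b : random_element z -> K a -> L b -> bounded_rv (Phi a b \o z).
Proof.
move=> rz Ka Lb; apply: (borel_fun_bounded_rv rz (Phi_borel Ka Lb)) => s.
exact: Phi_bounded.
Qed.

Lemma Ex_param_cvg (y : nat -> X) (u : nat -> V) y0 u0 :
  (forall n, K (y n)) -> (forall n, L (u n)) -> K y0 -> L u0 ->
  y n @[n --> \oo] --> y0 -> u n @[n --> \oo] --> u0 ->
  q (y n) (u n) @[n --> \oo] --> q y0 u0.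
Proof.
move=> Ky Lu Ky0 Lu0 yy0 uu0; apply: (@Ex_cvg _ _ _ P _ _ M).
- by move=> n; have [] := bPhi mx' (Ky n) (Lu n).
- by move=> n w; exact: Phi_bounded.
- by move=> w; exact: Phi_cont.
Qed.

Lemma Ex_param_bounded a b : K a -> L b -> `|q a b| <= M.
Proof. by move=> Ka Lb; apply: Ex_norm_le; [exact: bPhi|move=> w; exact: Phi_bounded]. Qed.

Lemma bounded_rv_caratheodory (y : Om -> X) (u : Om -> V) (z : Om -> S) :
  measurable_in G y -> measurable_in G u -> random_element z ->
  (forall w, K (y w)) -> (forall w, L (u w)) ->
  bounded_rv (fun w => Phi (y w) (u w) (z w)).
Proof.
move=> my mu mz Ky Lu; split; last by exists M => w; exact: Phi_bounded.
apply: (@measurable_in_fun (@measurable _ Om)) => //.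
apply: (measurable_in_caratheodory measurable_sigma_algebra cK cL Phi_cont Phi_borel) => //.
- by move=> B bB; apply: Gm; exact: my.
- by move=> B bB; apply: Gm; exact: mu.
Qed.

Lemma bounded_rv_param (y : Om -> X) (u : Om -> V) :
  measurable_in G y -> measurable_in G u ->
  (forall w, K (y w)) -> (forall w, L (u w)) ->
  bounded_rv (fun w => q (y w) (u w)).
Proof.
move=> my mu Ky Lu; split; last by exists M => w; exact: Ex_param_bounded.
apply: (@measurable_in_fun G) => //.
(* [q] has no noise argument, so a constant one is supplied. *)
apply: (@measurable_in_caratheodory _ _ _ sG _ _ _ S K L (fun a b _ => q a b) cK cL _ _ _ _ (fun=> x point)) => //.
- by move=> _ y1 u1 y0 u0; exact: Ex_param_cvg.
- by move=> a b _ _; apply: measurable_in_cst; exact: borel_sigma_algebra.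
- exact: measurable_in_cst.
Qed.

(* The first two arguments are frozen by approximating [(y, u)] with finitely
   valued maps, on whose level sets independence applies. *)
Theorem Ex_freezing (y : Om -> X) (u : Om -> V) :
  measurable_in G y -> measurable_in G u ->
  (forall w, K (y w)) -> (forall w, L (u w)) ->
  Ex P (fun w => Phi (y w) (u w) (x w)) = Ex P (fun w => q (y w) (u w)).
Proof.
move=> my mu Ky Lu.
have [y_ [Ky_ fy Gy yl]] := finite_valued_approx sG cK my Ky.
have [u_ [Lu_ fu Gu ul]] := finite_valued_approx sG cL mu Lu.
pose p n w := (y_ n w, u_ n w).
have Gp n a : G [set w | p n w = a].
  rewrite (_ : [set w | _] = [set w | y_ n w = a.1] `&` [set w | u_ n w = a.2]).
    exact: sigma_algebra_setI.
  by apply/seteqP; split => w /=; case: a => a b; rewrite /p /= => -[-> ->].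
have mp n a : measurable [set w | p n w = a] by exact: Gm.
have key n : Ex P (fun w => Phi (y_ n w) (u_ n w) (x w)) =
    Ex P (fun w => q (y_ n w) (u_ n w)).
  have [ly lyP] := fy n; have [lu luP] := fu n.
  have pl w : p n w \in [seq (a, b) | a <- ly, b <- lu].
    by apply/allpairsP; exists (p n w); split => /=.
  rewrite (@Ex_finite_valued _ (p n) _ (fun a w => Phi a.1 a.2 (x w)) pl)//; last first.
    by move=> w; exact: (bPhi mx (Ky_ n w) (Lu_ n w)).
  rewrite (@Ex_finite_valued _ (p n) _ (fun a w => q a.1 a.2) pl)//; last first.
    by move=> w; exact: bounded_rv_cst.
  apply: eq_bigr => -[a b] _.
  have [[w [/= wa wb]]|na] := pselect (exists w, p n w = (a, b)); last first.
    congr Ex; apply/funext => w; rewrite indicE memNset ?mul0r//= => wa.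
    by apply: na; exists w.
  have Ka : K a by rewrite -wa.
  have Lb : L b by rewrite -wb.
  rewrite (@Ex_indic_indep _ (Phi a b) M) //.
  - rewrite (_ : (fun _ => _) = (fun w => q a b * \1_[set w' | p n w' = (a, b)] w)).
      by rewrite ExZ; [rewrite mulrC|exact: bounded_rv_indic].
    by apply/funext => ?; rewrite mulrC.
  - exact: Phi_borel.
  - by move=> s; exact: Phi_bounded.
have my_ n : measurable_in G (y_ n).
  by have [l lP] := fy n; exact: measurable_in_finite_valued lP (Gy n).
have mu_ n : measurable_in G (u_ n).
  by have [l lP] := fu n; exact: measurable_in_finite_valued lP (Gu n).
have c1 : Ex P (fun w => Phi (y_ n w) (u_ n w) (x w)) @[n --> \oo] -->
    Ex P (fun w => Phi (y w) (u w) (x w)).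
  apply: (@Ex_cvg _ _ _ P _ _ M).
  - by move=> n; case: (bounded_rv_caratheodory (my_ n) (mu_ n) mx (Ky_ n) (Lu_ n)).
  - by move=> n w; exact: Phi_bounded.
  - by move=> w; exact: Phi_cont.
have c2 : Ex P (fun w => q (y_ n w) (u_ n w)) @[n --> \oo] -->
    Ex P (fun w => q (y w) (u w)).
  apply: (@Ex_cvg _ _ _ P _ _ M).
  - by move=> n; case: (bounded_rv_param (my_ n) (mu_ n) (Ky_ n) (Lu_ n)).
  - by move=> n w; exact: Ex_param_bounded.
  - by move=> w; exact: Ex_param_cvg.
apply: (cvg_unique _ c1); first exact: Rhausdorff.
by move: c2; under eq_fun do rewrite -key.
Qed.

End freezing.

(** * The filtration generated by the noise *)

Section noise_filtration.
Context d (Om : measurableType d) (R : realType) (P : probability Om R).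
Context (S : topologicalType) (s : nat -> Om -> S).
Hypothesis s_iid : iid P s.

(** Rectangles with trivial coordinates from [t] on: a pi-system generating the sigma-algebra of the
    noise strictly before time [t]. Infinite families make intersections coordinatewise and
    monotonicity in [t] immediate. *)
Definition noise_cylinder (t : nat) : set (set Om) :=
  [set A | exists B : nat -> set S, [/\ forall j, borel (B j),
     forall j, (t <= j)%N -> B j = setT & A = \bigcap_j s j @^-1` B j]].

Definition noise_filtration (t : nat) : set (set Om) := <<s noise_cylinder t >>.

Let s_meas t : random_element (s t). Proof. by case: s_iid. Qed.

Lemma borelT (T : topologicalType) : borel [set: T].
Proof. by apply: open_borel; exact: openT. Qed.

Lemma noise_filtration_sigma t : sigma_algebra setT (noise_filtration t).
Proof. exact: smallest_sigma_algebra. Qed.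

Lemma noise_cylinder_measurable t A : noise_cylinder t A -> measurable A.
Proof.
move=> [B [bB _ ->]]; apply: (sigma_algebra_bigcap_nat (@measurable_sigma_algebra _ Om)).
by move=> j; exact: s_meas.
Qed.

Lemma noise_filtration_measurable t A : noise_filtration t A -> measurable A.
Proof.
apply: smallest_sub; first exact: measurable_sigma_algebra.
by move=> B; exact: noise_cylinder_measurable.
Qed.

Lemma noise_filtrationS t : noise_filtration t `<=` noise_filtration t.+1.
Proof.
apply: smallest_sub; first exact: noise_filtration_sigma.
move=> A [B [bB BT ->]]; apply: sub_sigma_algebra.
by exists B; split => // j /ltnW; exact: BT.
Qed.

Lemma noise_in_filtration t : measurable_in (noise_filtration t.+1) (s t).
Proof.
move=> B bB; apply: sub_sigma_algebra.
exists (fun j => if j == t then B else setT); split.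
- by move=> j; case: ifP => // _; exact: borelT.
- by move=> j tj; rewrite gtn_eqF.
apply/seteqP; split => w H.
  by move=> j _ /=; case: eqP => // ->.
by have := H t Logic.I; rewrite /= eqxx.
Qed.

(** The sets satisfying the product formula form a Dynkin class, which contains the pi-system of
    cylinders. *)
Lemma noise_independent t A B : noise_filtration t A -> borel B ->
  P (A `&` s t @^-1` B) = (P A * P (s 0%N @^-1` B))%E.
Proof.
move=> FA bB; have [_ sid sind] := s_iid.
pose D := [set A | measurable A /\
  P (A `&` s t @^-1` B) = (P A * P (s 0%N @^-1` B))%E].
have mB : measurable (s t @^-1` B) by exact: s_meas.
have fin (C : set Om) : measurable C -> P C = (fine (P C))%:E.
  by move=> mC; rewrite fineK// fin_num_measure.
have dynD : dynkin D.
  split.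
  - split => //; rewrite setTI probability_setT mul1e; exact: sid.
  - move=> C [mC PC]; split; first exact: measurableC.
    have mCB : measurable (C `&` s t @^-1` B) by exact: measurableI.
    have mCB' : measurable (~` C `&` s t @^-1` B).
      by apply: measurableI => //; exact: measurableC.
    have : P (s t @^-1` B) = (P (C `&` s t @^-1` B) + P (~` C `&` s t @^-1` B))%E.
      rewrite -measureU//; first by rewrite -setIUl setUv setTI.
      by rewrite setIACA setICr set0I.
    rewrite probability_setC// PC -(sid t B bB) (fin _ mB) (fin _ mC) (fin _ mCB').
    move: (fine _) (fine _) (fine _) => c b e [E] /=; congr _%:E; lra.
  - move=> F tF DF; split; first by apply: bigcup_measurable => k _; case: (DF k).
    rewrite setI_bigcupl measure_bigcup//; last 2 first.
    + by move=> k _; apply: measurableI => //; case: (DF k).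
    + exact: trivIset_setIr.
    rewrite measure_bigcup//; last by move=> k _; case: (DF k).
    rewrite -(sid t B bB) muleC (fin _ mB) -nneseriesZl//.
    apply: eq_eseriesr => k _; have [_ E] := DF k.
    by rewrite -(fin _ mB) muleC (sid t B bB) -E.
have GI : setI_closed (noise_cylinder t).
  move=> _ _ [B1 [bB1 BT1 ->]] [B2 [bB2 BT2 ->]].
  exists (fun j => B1 j `&` B2 j); split.
  - by move=> j; exact: (sigma_algebra_setI (@borel_sigma_algebra S)).
  - by move=> j tj; rewrite BT1// BT2// setIT.
  - by apply/seteqP; split => w; [move=> [H1 H2] j _; split; [exact: H1|exact: H2]|
      move=> H; split => j _; have [] := H j Logic.I].
suff GD : noise_cylinder t `<=` D.
  move: FA; rewrite /noise_filtration -(setI_closed_g_dynkin_g_sigma_algebra GI) => FA.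
  by have [] : D A by apply: FA; split.
move=> _ [C [bC CT ->]]; split.
  by apply: (@noise_cylinder_measurable t); exists C.
(* Coordinate [t] of the cylinder is free, so [B] fits there and the intersection is again a finite
   rectangle, now up to [t] included. *)
pose C' j := if j == t then B else C j.
have bC' j : borel (C' j) by rewrite /C'; case: ifP.
have -> : \bigcap_j s j @^-1` C j `&` s t @^-1` B =
    \bigcap_(j in [set` iota 0 t.+1]) s j @^-1` C' j.
  apply/seteqP; split => w.
    move=> [H Bw] j _; rewrite /C' /=; case: eqP => [->//|_]; exact: H.
  move=> H; have Hj j : (j < t.+1)%N -> (s j @^-1` C' j) w.
    by move=> jt; apply: H => /=; rewrite -/(iota 0 t.+1) mem_iota.
  split; last by have := Hj t (ltnSn t); rewrite /C' /= eqxx.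
  move=> j _ /=; have [jt|tj] := ltnP j t; last by rewrite CT.
  by have := Hj j (leqW jt); rewrite /C' /= ltn_eqF.
have -> : \bigcap_j s j @^-1` C j = \bigcap_(j in [set` iota 0 t]) s j @^-1` C j.
  apply/seteqP; split => w H; first by move=> j _; exact: H.
  move=> j _ /=; have [jt|tj] := ltnP j t; last by rewrite CT.
  by apply: H => /=; rewrite mem_iota.
rewrite !sind//; [|exact: iota_uniq|exact: iota_uniq].
rewrite -addn1 iotaD big_cat /= add0n big_seq1 {2}/C' eqxx sid//; congr (_ * _)%E.
rewrite big_seq [RHS]big_seq; apply: eq_bigr => j; rewrite mem_iota add0n => /= jt.
by rewrite /C' ltn_eqF.
Qed.

End noise_filtration.

(** * Lower semicontinuous functions *)

Section lower_semicontinuity.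
Context {R : realType} {X : normedModType R}.
Variable Y : set X.

(** Lower semicontinuity as sequential closedness of the sublevel sets relative to [Y], which avoids
    lower limits. *)
Definition seq_lsc (g : X -> R) := forall (y : nat -> X) l c,
  (forall n, Y (y n)) -> Y l -> (forall n, g (y n) <= c) ->
  y n @[n --> \oo] --> l -> g l <= c.

Definition bounded_on (g : X -> R) (M : R) := forall y, Y y -> `|g y| <= M.

Definition seq_continuous (g : X -> R) := forall (y : nat -> X) l,
  (forall n, Y (y n)) -> Y l -> y n @[n --> \oo] --> l -> g (y n) @[n --> \oo] --> g l.

Lemma seq_continuous_lsc g : seq_continuous g -> seq_lsc g.
Proof. by move=> cg y l c Yy Yl gc yl; apply: cvg_le_cst gc; exact: cg. Qed.

Lemma seq_continuous_bounded g : compact Y -> seq_continuous g ->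
  exists M, bounded_on g M.
Proof.
move=> /compact_seq_compact cY cg; apply: contrapT => nb.
have /choice[y yP] n : exists y, Y y /\ n%:R < `|g y|.
  apply: contrapT => H; apply: nb; exists n%:R => y Yy; rewrite leNgt; apply/negP => gy.
  by apply: H; exists y.
have [|l [Yl [phi [phin yl]]]] := cY y; first by move=> n; case: (yP n).
have gl : g (y (phi n)) @[n --> \oo] --> g l by apply: cg => // n; case: (yP (phi n)).
have /cvg_seq_bounded [M [_ MP]] : cvgn (fun n => g (y (phi n))) by apply/cvg_ex; exists (g l).
have [_ +] := yP (phi (Num.truncn (`|M| + 1)).+1); apply/negP; rewrite -leNgt.
apply: le_trans (MP (`|M| + 1) _ _ _) _ => //.
  by rewrite (le_lt_trans (ler_norm _))// ltrDl.
apply: ltW; apply: lt_le_trans (truncnS_gt _) _.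
by rewrite ler_nat.
Qed.

Hypothesis Y_nonempty : Y !=set0.
Variables (g : X -> R) (M : R).
Hypotheses (gM : bounded_on g M).

(* Pasch-Hausdorff regularisation: the Lipschitz functions [lip_env m] increase
   to [g] on [Y] when [g] is lower semicontinuous. *)
Definition lip_env (m : nat) (y : X) : R :=
  Num.min M (inf [set g z + m%:R * `|y - z| | z in Y]).

Let D m y := [set g z + m%:R * `|y - z| | z in Y].

Let D_lb m y : lbound (D m y) (- M).
Proof.
move=> _ [z Yz <-]; have := gM Yz; rewrite ler_norml => /andP[gz _].
by rewrite (le_trans gz)// lerDl mulr_ge0.
Qed.

Let D_inf m y : has_inf (D m y).
Proof.
split; last by exists (- M); exact: D_lb.
by have [z Yz] := Y_nonempty; exists (g z + m%:R * `|y - z|), z.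
Qed.

Let D_le m y z : Y z -> inf (D m y) <= g z + m%:R * `|y - z|.
Proof. by move=> Yz; apply: ge_inf; [case: (D_inf m y)|exists z]. Qed.

Let le_D m y c : (forall z, Y z -> c <= g z + m%:R * `|y - z|) -> c <= inf (D m y).
Proof.
move=> H; apply: lb_le_inf; first by case: (D_inf m y).
by move=> _ [z Yz <-]; exact: H.
Qed.

(** The truncation in [lip_env] gives the bound on all of [X]: for a control outside [U y] the next
    state may leave [Y], and the freezing lemmas are applied over all controls. *)
Lemma lip_env_bounded m y : `|lip_env m y| <= M.
Proof.
have M0 : 0 <= M by have [z Yz] := Y_nonempty; exact: le_trans (gM Yz).
rewrite ler_norml /lip_env ge_min lexx andbT le_min ge0_cp//=.
by apply: le_D => z Yz; apply: (D_lb (m := m) (y := y)); exists z.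
Qed.

Lemma lip_env_le m y : Y y -> lip_env m y <= g y.
Proof.
move=> Yy; rewrite /lip_env ge_min; apply/orP; right.
by apply: le_trans (D_le m y Yy) _; rewrite subrr normr0 mulr0 addr0.
Qed.

Lemma lip_env_mono m m' y : (m <= m')%N -> lip_env m y <= lip_env m' y.
Proof.
move=> mm'; rewrite /lip_env le_min ge_min lexx /=.
rewrite ge_min; apply/orP; right; apply: le_D => z Yz.
apply: le_trans (D_le m y Yz) _; rewrite lerD2l ler_wpM2r//.
by rewrite ler_nat.
Qed.

Lemma lip_env_lipschitz m y y' : lip_env m y <= lip_env m y' + m%:R * `|y - y'|.
Proof.
rewrite /lip_env -lerBlDr le_min; apply/andP; split.
  by rewrite lerBlDr ge_min lerDl mulr_ge0.
apply: le_D => z Yz; rewrite lerBlDr ge_min; apply/orP; right.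
apply: le_trans (D_le m y Yz) _.
rewrite -addrA lerD2l -mulrDr ler_wpM2l// [leRHS]addrC; exact: ler_distD.
Qed.

Lemma lip_env_continuous m : continuous (lip_env m).
Proof.
move=> y; apply/cvgrPdist_le => e e0.
have m1 : 0 < m%:R + 1 :> R by rewrite ltr_wpDl.
near=> y'.
have yy' : `|y - y'| <= e / (m%:R + 1).
  near: y'; apply: cvgr_dist_le; first exact: cvg_id.
  exact: divr_gt0.
have le : m%:R * `|y - y'| <= e.
  apply: le_trans (ler_wpM2l _ yy') _ => //.
  by rewrite mulrA ler_pdivrMr//; lra.
rewrite ler_distl; apply/andP; split.
  by rewrite lerBlDr (le_trans (lip_env_lipschitz m y' y))// lerD2l distrC.
by rewrite (le_trans (lip_env_lipschitz m y y'))// lerD2l.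
Unshelve. all: by end_near. Qed.

Hypothesis g_lsc : seq_lsc g.

(** Otherwise near-minimisers [z m] with [m%:R * |y - z m|] bounded would converge to [y] at values
    below [g y]. *)
Lemma lip_env_approx y c : Y y -> c < g y -> exists m, c < lip_env m y.
Proof.
move=> Yy cg; apply: contrapT => H.
have gMy : g y <= M by exact: le_trans (ler_norm _) (gM Yy).
pose c' := (c + g y) / 2.
have cc' : c < c' by rewrite /c'; lra.
have c'g : c' < g y by rewrite /c'; lra.
have /choice[z zP] m : exists z, Y z /\ g z + m%:R * `|y - z| < c'.
  apply: contrapT => nz; apply: H; exists m; apply: (lt_le_trans cc').
  rewrite /lip_env le_min (le_trans (ltW c'g) gMy) /=; apply: le_D => z Yz.
  by rewrite leNgt; apply/negP => zc; apply: nz; exists z.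
have zy : z m @[m --> \oo] --> y.
  have B m : m%:R * `|y - z m| <= c' + M.
    have [Yz zc] := zP m; have := gM Yz; rewrite ler_norml => /andP[gz _].
    lra.
  apply/cvgrPdist_le => e e0; near=> m.
  have m0 : 0 < m%:R :> R by rewrite ltr0n; near: m; exists 1%N.
  rewrite -(ler_pM2l m0); apply: le_trans (B m) _.
  rewrite -ler_pdivrMr//; near: m; apply: nbhs_infty_ger.
have : g y <= c'.
  apply: (@g_lsc z y) => // m; have [Yz zc] := zP m => //.
  by apply: ltW; apply: le_lt_trans zc; rewrite lerDl mulr_ge0.
by rewrite leNgt c'g.
Unshelve. all: by end_near. Qed.

Lemma lip_env_cvg y : Y y -> lip_env m y @[m --> \oo] --> g y.
Proof.
move=> Yy; apply/cvgrPdist_le => e e0.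
have [|N NP] := @lip_env_approx y (g y - e) Yy; first by rewrite ltrBlDr ltrDl.
exists N => // m /= Nm; rewrite ler_distl; apply/andP; split.
  by rewrite lerBlDr (le_trans (lip_env_le m Yy))// lerDl ltW.
by rewrite -lerBlDr (le_trans (ltW NP))// lip_env_mono.
Qed.

End lower_semicontinuity.

(** * A Fatou inequality for finitely additive means *)

Section finitely_additive_fatou.
Context {R : realType} {T : pseudoMetricType R}.
Variables (K : set T) (B : (T -> R) -> Prop).
Hypotheses (K_compact : seq_compact K)
  (B_bounded : forall g, B g -> exists M, forall x, K x -> `|g x| <= M)
  (B_cst : forall c, B (fun=> c))
  (B_add : forall g h, B g -> B h -> B (fun x => g x + h x))
  (B_max : forall g h, B g -> B h -> B (fun x => Num.max (g x) (h x)))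
  (B_min : forall g h, B g -> B h -> B (fun x => Num.min (g x) (h x))).

Definition normalized_positive (I : (T -> R) -> R) := [/\
  forall c, I (fun=> c) = c,
  forall g h, B g -> B h -> I (fun x => g x + h x) = I g + I h &
  forall g h, B g -> B h -> (forall x, K x -> g x <= h x) -> I g <= I h].

Section single_functional.
Variables (I : (T -> R) -> R) (q : nat -> T -> R) (C e : R).
Hypotheses (I_pos : normalized_positive I) (Bq : forall m, B (q m))
  (qC : forall m x, K x -> q m x <= C)
  (q_closed : forall m, closed (K `&` [set x | e / 4 <= q m x]))
  (e0 : 0 < e) (Iq : forall m, e <= I (q m)).

Let G := fix G (m j : nat) (x : T) : R :=
  if j is i.+1 then Num.max (G m i x) (q (m + j) x) else q m x.

Let BG m j : B (G m j).
Proof. by elim: j => [|j IH] /=; [exact: Bq|exact: B_max]. Qed.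

Let GC m j x : K x -> G m j x <= C.
Proof. by move=> Kx; elim: j => [|j IH] /=; rewrite ?ge_max ?qC ?IH. Qed.

Let G_ge m j x : q m x <= G m j x.
Proof. by elim: j => [|j IH] //=; rewrite le_max IH. Qed.

Let G_mono m i j x : (i <= j)%N -> G m i x <= G m j x.
Proof.
move=> /subnK <-; elim: (j - i)%N => [|k IH]; first by rewrite add0n.
by rewrite addSn /= le_max IH.
Qed.

Let G_shift m j x : G m.+1 j x <= G m j.+1 x.
Proof.
elim: j => [|j IH]; first by rewrite /= addn1 le_max lexx orbT.
rewrite [G m.+1 j.+1 x]/= [G m j.+2 x]/= ge_max !le_max addSnnS lexx orbT andbT.
by move: IH; rewrite [G m j.+1 x]/= le_max => ->.
Qed.

Let G_closed m j : closed (K `&` [set x | e / 4 <= G m j x]).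
Proof.
elim: j => [|j IH] /=; first exact: q_closed.
rewrite (_ : _ `&` _ = (K `&` [set x | e / 4 <= G m j x]) `|`
  (K `&` [set x | e / 4 <= q (m + j.+1) x])); first exact: closedU.
by apply/seteqP; split => x /=; rewrite le_max;
  [move=> [Kx /orP[]]; [left|right]|move=> [[? ->]|[? ->]]; rewrite ?orbT].
Qed.

Let G_attained m j x : exists2 i, (m <= i)%N & G m j x = q i x.
Proof.
elim: j => [|j [i mi Gi]] /=; first by exists m.
case: (leP (G m j x) (q (m + j.+1) x)) => _; last by exists i.
by exists (m + j.+1)%N => //; exact: leq_addr.
Qed.

(* The supremum of [q i] over [i >= m] is nearly exhausted by a finite maximum
   [G m j]; the minimum of the first of these keeps mean at least [e / 2] because
   the errors [e / 2 ^+ m.+2] sum to at most [e / 2], and its superlevel sets are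
   nested compacts. *)
Let almost_sup m : exists j, forall j', I (G m j') <= I (G m j) + e / 2 ^+ m.+2.
Proof.
have [Ic Ia Ile] := I_pos.
pose D := [set I (G m j) | j in [set: nat]].
have hD : has_sup D.
  split; first by exists (I (G m 0)), 0%N.
  by exists C => _ [j _ <-]; rewrite -[leRHS]Ic; apply: Ile => // x; exact: GC.
have d0 : 0 < e / 2 ^+ m.+2 by rewrite divr_gt0// exprn_gt0.
have [_ [j _ <-] Ij] := sup_adherent d0 hD; exists j => j'.
rewrite -lerBlDr; apply: le_trans (ltW Ij); rewrite lerD2r.
by apply: ub_le_sup; [case: hD|exists j'].
Qed.

Theorem finitely_additive_fatou :
  exists2 x, K x & forall n, exists2 m, (n <= m)%N & e / 4 <= q m x.
Proof.
have [Ic Ia Ile] := I_pos.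
have [j jP] := choice almost_sup.
pose H m := G m (j m).
pose L := fix L M := if M is M'.+1 then (fun x => Num.min (L M' x) (H M x)) else H 0%N.
have BL M : B (L M) by elim: M => [|M IH] /=; [exact: BG|apply: B_min => //; exact: BG].
have LH M x : L M x <= H M x by case: M => [|M] //=; rewrite ge_min lexx orbT.
(* The loss from taking minima is summed: passing from [M] to [M.+1] costs at most the error of
   [almost_sup M]. *)
have IL M : I (H M) - I (L M) <= e / 2 - e / 2 ^+ M.+1.
  elim: M => [|M IH]; first by rewrite /= expr1 !subrr.
  have BH m : B (H m) by exact: BG.
  have Imax : I (fun x => Num.max (H M x) (H M.+1 x)) <= I (H M) + e / 2 ^+ M.+2.
    (* A window starting at [M] long enough to contain those of [H M] and [H M.+1]. *)
    apply: le_trans (jP M (maxn (j M) (j M.+1).+1)); apply: Ile.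
    - exact: B_max.
    - exact: BG.
    - move=> x _; rewrite ge_max; apply/andP; split; first exact/G_mono/leq_maxl.
      by apply: le_trans (G_shift _ _ _) _; exact/G_mono/leq_maxr.
  (* A sum is minimum plus maximum, and [L M <= H M] enlarges the maximum to one controlled by
     [Imax]. *)
  have : I (fun x => H M.+1 x + L M x) <=
      I (fun x => L M.+1 x + Num.max (H M x) (H M.+1 x)).
    apply: Ile; [exact: B_add|apply: B_add => //; exact: B_max|move=> x _ /=].
    have := LH M x.
    by case: (leP (L M x) (H M.+1 x)); case: (leP (H M x) (H M.+1 x)); lra.
  rewrite !Ia//; last exact: B_max.
  have E2 : e / 2 ^+ M.+1 = e / 2 ^+ M.+2 + e / 2 ^+ M.+2.
    rewrite [X in _ = e / X + e / X]exprS invfM.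
    have : (2 : R) * 2^-1 = 1 by rewrite divff.
    by move: (2^-1) (2 ^+ M.+1)^-1 => a d a1; nra.
  move: E2 IH Imax; move: (e / 2 ^+ M.+1) (e / 2 ^+ M.+2) => a1 a2; lra.
have IL2 M : e / 2 <= I (L M).
  have eH : e <= I (H M).
    apply: le_trans (Iq M) _; apply: Ile => //; first exact: BG.
    by move=> x _; exact: G_ge.
  have d0 : 0 < e / 2 ^+ M.+1 by rewrite divr_gt0// exprn_gt0.
  by have := IL M; lra.
have L_closed M : closed (K `&` [set x | e / 4 <= L M x]).
  elim: M => [|M IH] /=; first exact: G_closed.
  rewrite (_ : _ `&` _ = (K `&` [set x | e / 4 <= L M x]) `&`
    (K `&` [set x | e / 4 <= H M.+1 x])); first by apply: closedI => //; exact: G_closed.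
  by apply/seteqP; split => x /=; rewrite le_min; [move=> [? /andP[]]|move=> [[? ->] [_ ->]]].
have [||i i' ii'|M|x xP] := @seq_compact_nested T (fun M => K `&` [set x | e / 4 <= L M x]).
- move=> x Kx; have [n|l [_ [phi [phin xl]]]] := K_compact (x := x); first by case: (Kx n).
  exists l; split; last by exists phi.
  by apply: (closed_seq (L_closed 0%N) _ xl) => n; exact: Kx.
- by move=> n x l Kx xl; exact: (closed_seq (L_closed n) _ xl).
- move: ii' => /subnK <-; elim: (i' - i)%N => // k IH x [Kx]; rewrite addSn /= le_min.
  by move=> /andP[? _]; exact: IH.
(* An empty superlevel set would bound the mean by [e / 4], below the [e / 2] that survives. *)
- apply: contrapT => nL; have : I (L M) <= e / 4.
    rewrite -[leRHS]Ic; apply: Ile => // x Kx; rewrite leNgt; apply/negP => /ltW Lx.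
    by apply: nL; exists x.
  by have := IL2 M; move: e0; lra.
exists x; first by case: (xP 0%N).
move=> n; have [_ /= Ln] := xP n; have [m nm Em] := G_attained n (j n) x.
by exists m => //; rewrite -Em; exact: le_trans Ln (LH n x).
Qed.

End single_functional.

Lemma ultra_cvg_bounded (F : set_system nat) (x : nat -> R) (M : R) : UltraFilter F ->
  (forall n, `|x n| <= M) -> exists l : R, x n @[n --> F] --> l.
Proof.
move=> UF xM.
have cM : compact `[- M, M]%classic by exact: segment_compact.
have [|l [_ cl]] := cM (x @ F) _.
  by rewrite /fmap /= /nbhs /=; apply: filterE => n; rewrite /= in_itv /= -ler_norml.
exists l => A Al; have [//|FA] := in_ultra_setVsetC (x @^-1` A) UF.
have [y [nAy Ay]] := cl (~` A) A FA Al; case: (nAy Ay).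
Qed.

(* The functionals [J n] are averaged along an ultrafilter. *)
Theorem finitely_additive_fatou_seq (J : nat -> (T -> R) -> R) (q : nat -> T -> R)
  (C e : R) :
  (forall n, normalized_positive (J n)) -> (forall m, B (q m)) ->
  (forall m x, K x -> q m x <= C) ->
  (forall m, closed (K `&` [set x | e / 4 <= q m x])) -> 0 < e ->
  (forall m, \forall n \near \oo, e <= J n (q m)) ->
  exists2 x, K x & forall n, exists2 m, (n <= m)%N & e / 4 <= q m x.
Proof.
move=> Jpos Bq qC qcl e0 Jq.
have [F [UF ooF]] := @ultraFilterLemma nat \oo _.
have FP : ProperFilter F := @ultra_proper _ F UF.
have JM g : B g -> exists M, forall n, `|J n g| <= M.
  move=> Bg; have [M gM] := B_bounded Bg; exists M => n.
  have [Jc Ja Jle] := Jpos n.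
  rewrite ler_norml -[X in X <= _](Jc (- M)) -[X in _ && (_ <= X)](Jc M); apply/andP; split; apply: Jle => // x Kx.
    by have := gM x Kx; rewrite ler_norml => /andP[].
  by have := gM x Kx; rewrite ler_norml => /andP[].
pose I g := lim (J n g @[n --> F]).
have JI g : B g -> J n g @[n --> F] --> I g.
  move=> Bg; have [M gM] := JM g Bg; have [l ll] := ultra_cvg_bounded UF gM.
  by apply/cvg_ex; exists l.
have I_pos : normalized_positive I.
  split.
  - move=> c; apply: cvg_lim => //.
    rewrite (_ : (fun n => _) = fun=> c); first exact: cvg_cst.
    by apply/funext => n; have [] := Jpos n.
  - move=> g h Bg Bh; apply: cvg_lim => //.
    rewrite (_ : (fun n => _) = fun n => J n g + J n h); first by apply: cvgD; exact: JI.
    by apply/funext => n; have [_ Ja _] := Jpos n; rewrite Ja.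
  - move=> g h Bg Bh gh; rewrite -subr_ge0.
    apply: (@closed_cvg _ _ F _ (fun n => J n h - J n g) [set y | 0 <= y]).
    + exact: closed_ge.
    + by apply: filterE => n /=; rewrite subr_ge0; have [_ _] := Jpos n; apply.
    + by apply: cvgB; exact: JI.
apply: (@finitely_additive_fatou I q C e) => // m.
apply: (@closed_cvg _ _ F _ (fun n => J n (q m)) [set y | e <= y]).
- exact: closed_ge.
- exact: ooF (Jq m).
- exact: JI.
Qed.

End finitely_additive_fatou.

(** * Tails of discounted sums *)

Lemma discounted_tail (R : realType) (a : nat -> R) (b C : R) : 0 <= b < 1 -> (forall t, `|a t| <= C) ->
  cvgn (series (fun t => b ^+ t * a t)) /\
  forall N, `|limn (series (fun t => b ^+ t * a t)) - \sum_(0 <= t < N) b ^+ t * a t| <=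
    C * b ^+ N / (1 - b).
Proof.
move=> /andP[b0 b1] aC.
have b1' : 0 < 1 - b by rewrite subr_gt0.
have cv : cvgn (series (fun t => b ^+ t * a t)).
  apply: normed_cvg; apply: (@series_le_cvg _ _ (geometric C b)) => //.
  - by move=> n; exact: normr_ge0.
  - by move=> n; rewrite /= mulr_ge0 ?exprn_ge0// (le_trans _ (aC 0%N)).
  - by move=> n; rewrite /= normrM normrX ger0_norm// mulrC ler_wpM2r ?exprn_ge0.
  - by apply: is_cvg_geometric_series; rewrite ger0_norm.
split => // N.
(* The factor [1 - b ^+ n] comes from the partial geometric sum and makes the induction on the bound
   close with equality. *)
have tail n : `|\sum_(0 <= t < n + N) b ^+ t * a t - \sum_(0 <= t < N) b ^+ t * a t| <=
    C * b ^+ N / (1 - b) * (1 - b ^+ n).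
  elim: n => [|n IH]; first by rewrite add0n subrr normr0 expr0 subrr mulr0.
  rewrite addSn big_nat_recr//= addrAC (le_trans (ler_normD _ _))//.
  have step : `|b ^+ (n + N) * a (n + N)%N| <= C * b ^+ N * b ^+ n.
    have -> : C * b ^+ N * b ^+ n = C * b ^+ (n + N) by rewrite exprD; ring.
    by rewrite normrM normrX ger0_norm// [leLHS]mulrC ler_wpM2r// exprn_ge0.
  apply: le_trans (lerD IH step) _.
  rewrite le_eqVlt; apply/orP; left; apply/eqP.
  by rewrite exprS; field; rewrite gt_eqF.
have C0 : 0 <= C by exact: le_trans (aC 0%N).
have lim0 : `|series (fun t => b ^+ t * a t) (n + N)%N - \sum_(0 <= t < N) b ^+ t * a t|
    @[n --> \oo] --> `|limn (series (fun t => b ^+ t * a t)) - \sum_(0 <= t < N) b ^+ t * a t|.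
  apply: cvg_norm; apply: cvgB; last exact: cvg_cst.
  exact: (cvg_subseq (fun n => leq_addr N n) cv).
apply: (cvg_le_cst lim0) => n; apply: le_trans (tail n) _.
have D0 : 0 <= C * b ^+ N / (1 - b).
  by apply: divr_ge0; [apply: mulr_ge0 => //; exact: exprn_ge0|exact: ltW].
by rewrite ler_piMr// gerBl exprn_ge0.
Qed.

(** * Controlled system *)

Section controlled_system.
Context d (Om : measurableType d) (R : realType) (P : probability Om R).
Context (X : normedModType R) (V : metricType R) (S : topologicalType).
Variables (Y : set X) (U : X -> set V) (f : X -> V -> S -> X) (s : nat -> Om -> S).
Hypotheses (Y_nonempty : Y !=set0) (Y_compact : compact Y)
  (V_compact : compact [set: V])
  (f_cont : forall x (y : nat -> X) (u : nat -> V) y0 u0,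
    (forall n, Y (y n)) -> Y y0 -> y n @[n --> \oo] --> y0 ->
    u n @[n --> \oo] --> u0 -> f (y n) (u n) x @[n --> \oo] --> f y0 u0 x)
  (f_borel : forall y u, Y y -> forall B, borel B -> borel (f y u @^-1` B))
  (s_iid : iid P s)
  (f_viable : forall y u x, Y y -> U y u -> Y (f y u x)).

Definition transition (g : X -> R) (y : X) (u : V) : R :=
  Ex P (fun w => g (f y u (s 0%N w))).

(** The class preserved by the Bellman operator; continuity is not preserved, since [U] may jump. *)
Definition bounded_lsc (g : X -> R) := seq_lsc Y g /\ exists M, bounded_on Y g M.

Let F := noise_filtration s.
Let FS t : sigma_algebra setT (F t) := noise_filtration_sigma s t.
Let Fm t A : F t A -> measurable A := @noise_filtration_measurable _ _ _ _ _ _ s_iid t A.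
Let s_rv t : random_element (s t). Proof. by case: s_iid. Qed.
Let mS := @measurable_sigma_algebra _ Om.

Lemma Y_closed : closed Y.
Proof. exact: compact_closed (@norm_hausdorff _ _) Y_compact. Qed.

Lemma bounded_rv_lsc g (z : Om -> X) : bounded_lsc g ->
  measurable_in (@measurable _ Om) z -> (forall w, Y (z w)) -> bounded_rv (g \o z).
Proof.
move=> [lg [M gM]] mz Yz.
apply: (@bounded_rv_cvg _ _ _ (fun m w => lip_env Y g M m (z w)) _ M).
- move=> m; apply: (@measurable_in_fun _ _ _ (@measurable _ Om)) => //.
  apply: (measurable_in_continuous mS _ mz).
  by apply: lip_env_continuous => //; exact: Y_nonempty.
- by move=> m w; exact: lip_env_bounded.
- by move=> w; exact: lip_env_cvg.
Qed.

Lemma bounded_rv_transition g y u t : bounded_lsc g -> Y y -> U y u ->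
  bounded_rv (fun w => g (f y u (s t w))).
Proof.
move=> bg Yy Uu; apply: (bounded_rv_lsc (z := fun w => f y u (s t w)) bg).
  by move=> B bB; exact (s_rv t (f_borel u Yy bB)).
by move=> w; exact: f_viable.
Qed.

Lemma transition_le g g' y u : bounded_lsc g -> bounded_lsc g' -> Y y -> U y u ->
  (forall z, Y z -> g z <= g' z) -> transition g y u <= transition g' y u.
Proof.
move=> bg bg' Yy Uu gg'; apply: Ex_le; try exact: bounded_rv_transition.
by move=> w; apply: gg'; exact: f_viable.
Qed.

Lemma transition_bounded g M y u : bounded_lsc g -> bounded_on Y g M -> Y y -> U y u ->
  `|transition g y u| <= M.
Proof.
move=> bg gM Yy Uu; apply: Ex_norm_le; first exact: bounded_rv_transition.
by move=> w; apply: gM; exact: f_viable.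
Qed.

Lemma transition_cvg (g : nat -> X -> R) g' M y u :
  (forall n, bounded_lsc (g n)) -> (forall n, bounded_on Y (g n) M) ->
  (forall z, Y z -> g n z @[n --> \oo] --> g' z) -> Y y -> U y u ->
  transition (g n) y u @[n --> \oo] --> transition g' y u.
Proof.
move=> bg gM gg' Yy Uu; apply: (@Ex_cvg _ _ _ P _ _ M).
- by move=> n; have [] := bounded_rv_transition 0 (bg n) Yy Uu.
- by move=> n w; apply: gM; exact: f_viable.
- by move=> w; apply: gg'; exact: f_viable.
Qed.

Section lipschitz_transition.
Variables (g : X -> R) (M : R) (m : nat).
Hypothesis gM : bounded_on Y g M.
Let gm := lip_env Y g M m.

Let Phi y u x := gm (f y u x).

Let gm_cont : continuous gm. Proof. exact: lip_env_continuous. Qed.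

Lemma lip_transition_cont x (y : nat -> X) (u : nat -> V) y0 u0 :
  (forall n, Y (y n)) -> (forall n, [set: V] (u n)) -> Y y0 -> [set: V] u0 ->
  y n @[n --> \oo] --> y0 -> u n @[n --> \oo] --> u0 ->
  Phi (y n) (u n) x @[n --> \oo] --> Phi y0 u0 x.
Proof.
move=> Yy _ Yy0 _ yy0 uu0.
by rewrite /Phi; apply: continuous_cvg; [exact: gm_cont|exact: f_cont].
Qed.

Lemma lip_transition_borel y u : Y y -> [set: V] u -> measurable_in (@borel S) (Phi y u).
Proof.
move=> Yy _; apply: (measurable_in_continuous (@borel_sigma_algebra S) gm_cont).
by move=> B bB; exact: f_borel.
Qed.

Lemma lip_transition_bounded y u x : Y y -> [set: V] u -> `|Phi y u x| <= M.
Proof. by move=> _ _; exact: lip_env_bounded. Qed.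

Lemma lip_env_bounded_lsc : bounded_lsc gm.
Proof.
split; last by exists M => y _; exact: lip_env_bounded.
apply: seq_continuous_lsc => y l _ _ yl.
by apply: (cvg_comp _ _ yl); exact: gm_cont.
Qed.

Lemma transition_lip_cont (y : nat -> X) (u : nat -> V) y0 u0 :
  (forall n, Y (y n)) -> Y y0 -> y n @[n --> \oo] --> y0 ->
  u n @[n --> \oo] --> u0 ->
  transition gm (y n) (u n) @[n --> \oo] --> transition gm y0 u0.
Proof.
move=> Yy Yy0 yy0 uu0.
by apply: (@Ex_param_cvg _ _ _ P S (s 0%N) (s_rv 0%N) X V Y setT Phi M
  lip_transition_cont lip_transition_borel lip_transition_bounded).
Qed.

End lipschitz_transition.

(** Two limits in turn: with a fixed envelope below [g] the cost is continuous along the sequence,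
    then the envelopes increase to [g]. *)
Lemma transition_lsc (c : X -> V -> R) (b : R) g :
  0 <= b -> bounded_lsc g ->
  forall (y : nat -> X) (u : nat -> V) y0 u0 r,
    (forall n, Y (y n)) -> (forall n, U (y n) (u n)) -> Y y0 -> U y0 u0 ->
    y n @[n --> \oo] --> y0 -> u n @[n --> \oo] --> u0 ->
    c (y n) (u n) @[n --> \oo] --> c y0 u0 ->
    (forall n, c (y n) (u n) + b * transition g (y n) (u n) <= r) ->
    c y0 u0 + b * transition g y0 u0 <= r.
Proof.
move=> b0 bg y u y0 u0 r Yy Uu Yy0 Uu0 yy0 uu0 cc0 H.
have [lg [M gM]] := bg.
have bm m := lip_env_bounded_lsc m gM.
have tc : transition (lip_env Y g M m) y0 u0 @[m --> \oo] --> transition g y0 u0.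
  apply: (transition_cvg bm) => //; first by move=> m z _; exact: lip_env_bounded.
  by move=> z; exact: lip_env_cvg.
apply: (@cvg_le_cst _ (fun m => c y0 u0 + b * transition (lip_env Y g M m) y0 u0)).
  by apply: cvgD; [exact: cvg_cst|exact: cvgMr].
move=> m; apply: (@cvg_le_cst _
    (fun n => c (y n) (u n) + b * transition (lip_env Y g M m) (y n) (u n))).
  by apply: cvgD => //; apply: cvgMr; exact: transition_lip_cont.
move=> n; apply: le_trans (H n); rewrite lerD2l ler_wpM2l//.
by apply: transition_le => // z Yz; exact: lip_env_le.
Qed.

Section trajectory.
Variables (pi : nat -> X -> V) (y0 : X).
Hypotheses (pi_plan : control_plans Y U pi) (Yy0 : Y y0).

Local Notation yt := (state f s pi y0).
Local Notation ut := (control f s pi y0).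

Lemma control_admissible t w : Y (yt t w) -> U (yt t w) (ut t w).
Proof. by move=> Yt; rewrite /control; have [_] := pi_plan t; apply. Qed.

Lemma state_in t w : Y (yt t w).
Proof.
elim: t => [//|t IH] /=; apply: f_viable => //.
exact: (control_admissible IH).
Qed.

Lemma control_in t w : U (yt t w) (ut t w).
Proof. exact: control_admissible (state_in t w). Qed.

Lemma control_measurable t : measurable_in (F t) (yt t) -> measurable_in (F t) (ut t).
Proof.
move=> my B bB; have [mpi _] := pi_plan t.
rewrite (_ : _ @^-1` _ = yt t @^-1` (Y `&` pi t @^-1` B)); first exact: (my _ (mpi _ bB)).
by apply/seteqP; split => w /=; [split => //; exact: state_in|case].
Qed.

Lemma state_measurable t : measurable_in (F t) (yt t).
Proof.
elim: t => [|t IH]; first by apply: measurable_in_cst; exact: FS.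
apply: (@measurable_in_caratheodory R Om (F t.+1) (FS t.+1) X V X S Y setT f) => //.
- by move=> x y u y1 u1 Yy _ Yy1 _; exact: f_cont.
- by move=> y u Yy _; exact: f_borel.
- by move=> B bB; apply: noise_filtrationS; exact: IH.
- by move=> B bB; apply: noise_filtrationS; exact: (control_measurable IH).
- exact: noise_in_filtration.
- exact: state_in.
Qed.

Lemma state_rv t : measurable_in (@measurable _ Om) (yt t).
Proof. by move=> B bB; apply: (@Fm t); exact: state_measurable. Qed.

Lemma bounded_rv_state g t : bounded_lsc g -> bounded_rv (fun w => g (yt t w)).
Proof. by move=> bg; apply: (bounded_rv_lsc bg (@state_rv t)) => w; exact: state_in. Qed.

(** Freezing needs continuity in state and control, so it is applied to the envelopes of [g];
    bounded convergence then gives [g]. *)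
Lemma markov_property g t : bounded_lsc g ->
  bounded_rv (fun w => transition g (yt t w) (ut t w)) /\
  Ex P (fun w => g (yt t.+1 w)) = Ex P (fun w => transition g (yt t w) (ut t w)).
Proof.
move=> bg; have [lg [M gM]] := bg.
have my := state_measurable (t := t); have mu := control_measurable my.
have bm m := lip_env_bounded_lsc m gM.
have freeze m : Ex P (fun w => lip_env Y g M m (yt t.+1 w)) =
    Ex P (fun w => transition (lip_env Y g M m) (yt t w) (ut t w)).
  have H := @Ex_freezing _ _ _ P S (F t) (s t) (s 0%N) (FS t) (@Fm t) (s_rv t)
    (s_rv 0%N) (@noise_independent _ _ _ P _ s s_iid t) X V Y setT
    (fun y u x => lip_env Y g M m (f y u x)) M Y_compact V_compact
    (lip_transition_cont (m := m) gM) (lip_transition_borel m gM)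
    (lip_transition_bounded m gM)
    (yt t) (ut t) my mu (state_in t) (fun=> Logic.I).
  exact: H.
have bq m : bounded_rv (fun w => transition (lip_env Y g M m) (yt t w) (ut t w)).
  exact: (@bounded_rv_param _ _ _ P S (F t) (s t) (s 0%N) (FS t) (@Fm t)
    (s_rv 0%N) X V Y setT _ M Y_compact V_compact
    (lip_transition_cont (m := m) gM) (lip_transition_borel m gM)
    (lip_transition_bounded m gM)
    _ _ my mu (state_in t) (fun=> Logic.I)).
have tc w : transition (lip_env Y g M m) (yt t w) (ut t w) @[m --> \oo] -->
    transition g (yt t w) (ut t w).
  apply: (transition_cvg bm (M := M)) => //; try exact: state_in; last exact: control_in.
    by move=> m z _; exact: lip_env_bounded.
  by move=> z; exact: lip_env_cvg.
have qM m w : `|transition (lip_env Y g M m) (yt t w) (ut t w)| <= M.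
  apply: transition_bounded => //; [|exact: state_in|exact: control_in].
  by move=> z _; exact: lip_env_bounded.
split; first by apply: bounded_rv_cvg qM tc => m; case: (bq m).
have c1 := @Ex_cvg _ _ _ P _ _ M (fun m => (bq m).1) qM tc.
have c2 : Ex P (fun w => lip_env Y g M m (yt t.+1 w)) @[m --> \oo] -->
    Ex P (fun w => g (yt t.+1 w)).
  apply: (@Ex_cvg _ _ _ P _ _ M).
  - by move=> m; case: (bounded_rv_state t.+1 (bm m)).
  - by move=> m w; exact: lip_env_bounded.
  - by move=> w; apply: lip_env_cvg => //; exact: (state_in t.+1).
rewrite (funext freeze) in c2.
exact: (cvg_unique (@Rhausdorff R) c2 c1).
Qed.

Lemma bounded_rv_cost (c : X -> V -> R) (C : R) t :
  (forall (y : nat -> X) (u : nat -> V) y1 u1,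
    (forall n, Y (y n)) -> Y y1 -> y n @[n --> \oo] --> y1 ->
    u n @[n --> \oo] --> u1 -> c (y n) (u n) @[n --> \oo] --> c y1 u1) ->
  (forall y u, Y y -> `|c y u| <= C) ->
  bounded_rv (fun w => c (yt t w) (ut t w)).
Proof.
move=> c_cont cC; have my := state_measurable (t := t); have mu := control_measurable my.
split; last by exists C => w; apply: cC; exact: state_in.
apply: (@measurable_in_fun _ _ _ (F t)); first exact: Fm.
apply: (@measurable_in_caratheodory R Om (F t) (FS t) X V R S Y setT (fun y u _ => c y u)
  Y_compact V_compact _ _ _ _ (fun=> s 0%N point)) => //.
- by move=> _ y u y1 u1 Yy _ Yy1 _; exact: c_cont.
- by move=> y u _ _; apply: measurable_in_cst; exact: borel_sigma_algebra.
- exact: measurable_in_cst.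
- exact: state_in.
Qed.

End trajectory.

(** * Dynamic programming *)

Hypotheses (U_nonempty : forall y, Y y -> U y !=set0)
  (U_graph : forall (y : nat -> X) (u : nat -> V) y0 u0,
    (forall n, Y (y n)) -> (forall n, U (y n) (u n)) -> Y y0 ->
    y n @[n --> \oo] --> y0 -> u n @[n --> \oo] --> u0 -> U y0 u0).

Lemma transition_add_cst g a y u : bounded_lsc g -> Y y -> U y u ->
  transition (fun z => g z + a) y u = transition g y u + a.
Proof.
move=> bg Yy Uu; rewrite /transition ExD ?Ex_cst//; last exact: bounded_rv_cst.
exact: bounded_rv_transition.
Qed.

Lemma bounded_lsc_add_cst g a : bounded_lsc g -> bounded_lsc (fun z => g z + a).
Proof.
move=> [lg [M gM]]; split.
  move=> y l c Yy Yl H yl; rewrite -lerBrDr; apply: (lg y l) => // n.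
  by rewrite lerBrDr.
by exists (M + `|a|) => y Yy; rewrite (le_trans (ler_normD _ _))// lerD2r gM.
Qed.

Section dynamic_programming.
Variables (c : X -> V -> R) (C b : R).
Hypotheses (c_cont : forall (y : nat -> X) (u : nat -> V) y1 u1,
    (forall n, Y (y n)) -> Y y1 -> y n @[n --> \oo] --> y1 ->
    u n @[n --> \oo] --> u1 -> c (y n) (u n) @[n --> \oo] --> c y1 u1)
  (c_bound : forall y u, Y y -> `|c y u| <= C) (b0 : 0 <= b).

Definition stage_cost (g : X -> R) (y : X) (u : V) : R := c y u + b * transition g y u.

Definition bellman (g : X -> R) (y : X) : R := inf [set stage_cost g y u | u in U y].

(** Serves both parts: [b = 1] gives the total cost over [N] stages, [b < 1] the discounted cost
    truncated after [N] stages. *)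
Definition dp_value (N : nat) : X -> R := iter N bellman (fun=> 0).

Lemma stage_cost_lsc g (y : nat -> X) (u : nat -> V) y1 u1 r : bounded_lsc g ->
  (forall n, Y (y n)) -> (forall n, U (y n) (u n)) -> Y y1 ->
  y n @[n --> \oo] --> y1 -> u n @[n --> \oo] --> u1 ->
  (forall n, stage_cost g (y n) (u n) <= r) -> stage_cost g y1 u1 <= r.
Proof.
move=> bg Yy Uu Yy1 yy1 uu1 H; apply: (transition_lsc b0 bg Yy Uu Yy1 _ yy1 uu1) => //.
  exact: U_graph Yy Uu Yy1 yy1 uu1.
exact: c_cont.
Qed.

Lemma stage_cost_bounded g M y u : bounded_lsc g -> bounded_on Y g M -> Y y -> U y u ->
  `|stage_cost g y u| <= C + b * M.
Proof.
move=> bg gM Yy Uu; rewrite (le_trans (ler_normD _ _))// lerD ?c_bound//.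
by rewrite normrM ger0_norm// ler_wpM2l//; exact: transition_bounded.
Qed.

Lemma stage_cost_selector g : bounded_lsc g -> exists sg : X -> V,
  (forall y, Y y -> argmin_set (U y) (stage_cost g y) (sg y)) /\
  (forall B, borel B -> borel (Y `&` sg @^-1` B)).
Proof.
move=> bg; have [lg [M gM]] := bg.
have [y0 Yy0] := Y_nonempty; have [u0 Uu0] := U_nonempty Yy0.
apply: (@measurable_minimizer R X V Y (closed_borel Y_closed) V_compact U
  (stage_cost g) (- (C + b * M)) u0) => //.
- move=> y Yy u l Uu ul; apply: (@U_graph (fun=> y) u) => //; exact: cvg_cst.
- move=> y Yy u l r Uu Ul H ul.
  by apply: (@stage_cost_lsc g (fun=> y) u) => //; exact: cvg_cst.
- move=> y u Yy Uu; have := stage_cost_bounded bg gM Yy Uu.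
  by rewrite ler_norml => /andP[].
(* The set is even closed: witnessing controls accumulate, and the graph, [D] and the sublevel
   condition all pass to the limit. *)
move=> D r cD; apply: closed_borel; apply: seq_closed => y l Hy yl.
have Yl : Y l by apply: (closed_seq Y_closed _ yl) => n; case: (Hy n).
have /choice[u uP] n : exists u, [/\ U (y n) u, D u & stage_cost g (y n) u <= r].
  by have [_ [u H]] := Hy n; exists u.
have [|v [_ [phi [phin uv]]]] := compact_seq_compact V_compact (x := u); first by [].
have yphi := cvg_subseq phin yl.
split => //; exists v; split.
- apply: (U_graph _ _ _ yphi uv) => // n; last by case: (uP (phi n)).
  by case: (Hy (phi n)).
- by apply: (closed_seq cD _ uv) => n; case: (uP (phi n)).
- apply: (stage_cost_lsc bg _ _ _ yphi uv) => // n; last by case: (uP (phi n)).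
    by case: (Hy (phi n)).
  by case: (uP (phi n)).
Qed.

Lemma bellman_argmin g y u : argmin_set (U y) (stage_cost g y) u ->
  bellman g y = stage_cost g y u.
Proof.
move=> [Uu mu]; apply/eqP; rewrite eq_le; apply/andP; split.
  apply: ge_inf; last by exists u.
  by exists (stage_cost g y u) => _ [u' Uu' <-]; exact: mu.
apply: lb_le_inf; first by exists (stage_cost g y u), u.
by move=> _ [u' Uu' <-]; exact: mu.
Qed.

Lemma bellman_le g y u : bounded_lsc g -> Y y -> U y u -> bellman g y <= stage_cost g y u.
Proof.
move=> bg Yy Uu; have [sg [mg _]] := stage_cost_selector bg.
by rewrite (bellman_argmin (mg y Yy)); have [_] := mg y Yy; apply.
Qed.

Lemma bellman_bounded g M : bounded_lsc g -> bounded_on Y g M ->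
  bounded_on Y (bellman g) (C + b * M).
Proof.
move=> bg gM y Yy; have [sg [mg _]] := stage_cost_selector bg.
rewrite (bellman_argmin (mg y Yy)); apply: stage_cost_bounded => //.
by case: (mg y Yy).
Qed.

(** Minimising controls along the sequence accumulate at a control admissible for the limit
    state. *)
Lemma bellman_lsc g : bounded_lsc g -> bounded_lsc (bellman g).
Proof.
move=> bg; split; last first.
  by have [_ [M gM]] := bg; exists (C + b * M); exact: bellman_bounded.
move=> y l r Yy Yl H yl; have [sg [mg _]] := stage_cost_selector bg.
have [|v [_ [phi [phin uv]]]] := compact_seq_compact V_compact (x := fun n => sg (y n)).
  by [].
have yphi := cvg_subseq phin yl.
have Uphi n : U (y (phi n)) (sg (y (phi n))) by case: (mg _ (Yy (phi n))).
apply: (@le_trans _ _ (stage_cost g l v)).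
  by apply: bellman_le => //; exact: (U_graph _ _ _ yphi uv).
apply: (stage_cost_lsc bg _ _ _ yphi uv) => // n.
by rewrite -(bellman_argmin (mg _ (Yy (phi n)))).
Qed.

Lemma bellman_mono g g' a y : bounded_lsc g -> bounded_lsc g' -> Y y ->
  (forall z, Y z -> g z <= g' z + a) -> bellman g y <= bellman g' y + b * a.
Proof.
move=> bg bg' Yy gg'; have [sg [mg _]] := stage_cost_selector bg'.
have [Us _] := mg y Yy.
apply: le_trans (bellman_le bg Yy Us) _.
rewrite (bellman_argmin (mg y Yy)) /stage_cost -addrA lerD2l -mulrDr ler_wpM2l//.
rewrite -transition_add_cst//; apply: transition_le => //.
exact: bounded_lsc_add_cst.
Qed.

Lemma dp_value_lsc N : bounded_lsc (dp_value N).
Proof.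
elim: N => [|N IH]; last exact: bellman_lsc.
by split => [y l r _ _ /(_ 0%N)//|]; exists 0 => y _; rewrite normr0.
Qed.

Definition geometric_sum (N : nat) : R := \sum_(0 <= t < N) b ^+ t.

Lemma geometric_sumS N : geometric_sum N.+1 = 1 + b * geometric_sum N.
Proof.
rewrite /geometric_sum big_nat_recl//= expr0 mulr_sumr; congr (_ + _).
by apply: eq_bigr => t _; rewrite exprS.
Qed.

Lemma dp_value_bounded N : bounded_on Y (dp_value N) (geometric_sum N * C).
Proof.
elim: N => [|N IH] y Yy; first by rewrite normr0 /geometric_sum big_nil mul0r.
apply: le_trans (bellman_bounded (dp_value_lsc N) IH Yy) _.
by rewrite geometric_sumS mulrDl mul1r mulrA.
Qed.

Lemma dp_value_le N y u : Y y -> U y u ->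
  dp_value N.+1 y <= stage_cost (dp_value N) y u.
Proof. by move=> Yy Uu; apply: bellman_le => //; exact: dp_value_lsc. Qed.

(** One more stage cannot gain more than its cost bound; the case [N = 0] is propagated by
    [bellman_mono]. *)
Lemma dp_value_step N y : Y y -> dp_value N y <= dp_value N.+1 y + b ^+ N * C.
Proof.
elim: N y => [|N IH] y Yy.
  have := @dp_value_bounded 1 y Yy.
  rewrite geometric_sumS /geometric_sum big_nil mulr0 addr0 mul1r ler_norml => /andP[+ _].
  by have -> : dp_value 0 y = 0 by []; lra.
rewrite exprS -mulrA.
exact: (bellman_mono (dp_value_lsc N) (dp_value_lsc N.+1) Yy IH).
Qed.

Section plan_cost.
Variables (pi : nat -> X -> V) (y0 : X).
Hypotheses (pi_plan : control_plans Y U pi) (Yy0 : Y y0).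

Local Notation yt := (state f s pi y0).
Local Notation ut := (control f s pi y0).

Definition mean_cost (t : nat) : R := Ex P (fun w => c (yt t w) (ut t w)).

Lemma bounded_rv_stage t : bounded_rv (fun w => c (yt t w) (ut t w)).
Proof. exact: (bounded_rv_cost pi_plan Yy0 t c_cont c_bound). Qed.

Lemma Ex_stage_cost g t : bounded_lsc g ->
  bounded_rv (fun w => stage_cost g (yt t w) (ut t w)) /\
  Ex P (fun w => stage_cost g (yt t w) (ut t w)) =
    mean_cost t + b * Ex P (fun w => g (yt t.+1 w)).
Proof.
move=> bg; have [bt ->] := markov_property pi_plan Yy0 t bg.
split; first by apply: bounded_rvD; [exact: bounded_rv_stage|exact: bounded_rvZ].
by rewrite /stage_cost ExD ?ExZ//; [exact: bounded_rv_stage|exact: bounded_rvZ].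
Qed.

Lemma Ex_plan_cost N :
  Ex P (fun w => \sum_(0 <= t < N) b ^+ t * c (yt t w) (ut t w)) =
  \sum_(0 <= t < N) b ^+ t * mean_cost t.
Proof.
rewrite Ex_sum; last by move=> t; apply: bounded_rvZ; exact: bounded_rv_stage.
by apply: eq_bigr => t _; rewrite ExZ//; exact: bounded_rv_stage.
Qed.

Lemma bounded_rv_plan_cost N :
  bounded_rv (fun w => \sum_(0 <= t < N) b ^+ t * c (yt t w) (ut t w)).
Proof.
by apply: bounded_rv_sum => t; apply: bounded_rvZ; exact: bounded_rv_stage.
Qed.

Lemma Ex_state0 g : Ex P (fun w => g (yt 0%N w)) = g y0.
Proof. exact: (Ex_cst P (g y0)). Qed.

Lemma dp_value_lower N :
  dp_value N y0 <= \sum_(0 <= t < N) b ^+ t * mean_cost t.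
Proof.
(* Interpolation: follow the plan for [j] stages and pay the value of the remaining [N - j]. *)
suff H j : (j <= N)%N -> dp_value N y0 <= \sum_(0 <= t < j) b ^+ t * mean_cost t +
    b ^+ j * Ex P (fun w => dp_value (N - j) (yt j w)).
  by have := H N (leqnn N); rewrite subnn /= Ex_cst mulr0 addr0.
elim: j => [_|j IH jN]; first by rewrite big_nil add0r expr0 mul1r subn0 Ex_state0.
apply: (le_trans (IH (ltnW jN))); rewrite big_nat_recr//= -addrA lerD2l.
have -> : (N - j = (N - j.+1).+1)%N by rewrite -subSn// subSS.
have [bs Es] := Ex_stage_cost j (dp_value_lsc (N - j.+1)).
rewrite exprSr -mulrA -mulrDr ler_wpM2l ?exprn_ge0// -Es; apply: Ex_le => //.
  by apply: bounded_rv_state => //; exact: dp_value_lsc.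
move=> w; apply: dp_value_le; [exact: state_in|exact: control_in].
Qed.

End plan_cost.

Lemma dp_value_attained N : exists2 pi, control_plans Y U pi & forall y0, Y y0 ->
  \sum_(0 <= t < N) b ^+ t * mean_cost pi y0 t = dp_value N y0.
Proof.
have /choice[sg sgP] k := stage_cost_selector (dp_value_lsc k).
(* At time [t] there remain [N - t] stages, so the minimiser is taken against the value with
   [N - t.+1]. Beyond the horizon the subtraction truncates to 0, which still gives an admissible
   plan. *)
pose pi t := sg (N - t.+1)%N.
have pi_plan : control_plans Y U pi.
  move=> t; have [mg bg] := sgP (N - t.+1)%N; split; first exact: bg.
  by move=> y /mg[].
exists pi => // y0 Yy0.
suff H j : (j <= N)%N -> dp_value N y0 = \sum_(0 <= t < j) b ^+ t * mean_cost pi y0 t +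
    b ^+ j * Ex P (fun w => dp_value (N - j) (state f s pi y0 j w)).
  by rewrite (H N (leqnn N)) subnn /= Ex_cst mulr0 addr0.
elim: j => [_|j IH jN]; first by rewrite big_nil add0r expr0 mul1r subn0 Ex_state0.
rewrite (IH (ltnW jN)) big_nat_recr//= -addrA; congr (_ + _).
have -> : (N - j = (N - j.+1).+1)%N by rewrite -subSn// subSS.
have [bs Es] := Ex_stage_cost pi_plan Yy0 j (dp_value_lsc (N - j.+1)).
rewrite exprSr -mulrA -mulrDr; congr (_ * _); rewrite -Es; congr Ex; apply/funext => w.
apply: bellman_argmin; have [mg _] := sgP (N - j.+1)%N.
apply: mg; exact: state_in.
Qed.

End dynamic_programming.

(** * Correctors *)

Lemma sum_nat_shift (a : nat -> R) n :
  \sum_(0 <= t < n) a t.+1 = \sum_(0 <= t < n) a t + a n - a 0%N.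
Proof.
elim: n => [|n IH]; first by rewrite !big_nil add0r subrr.
by rewrite !big_nat_recr//= IH; ring.
Qed.

Lemma seq_continuous_bounded_lsc g : seq_continuous Y g -> bounded_lsc g.
Proof.
move=> cg; split; first exact: seq_continuous_lsc.
exact: seq_continuous_bounded.
Qed.

(** The Feller property, on admissible pairs, where the next state stays in [Y]. *)
Lemma seq_continuous_transition g : seq_continuous Y g ->
  forall (y : nat -> X) (u : nat -> V) y0 u0,
    (forall n, Y (y n)) -> (forall n, U (y n) (u n)) -> Y y0 -> U y0 u0 ->
    y n @[n --> \oo] --> y0 -> u n @[n --> \oo] --> u0 ->
    transition g (y n) (u n) @[n --> \oo] --> transition g y0 u0.
Proof.
move=> cg y u y0 u0 Yy Uu Yy0 Uu0 yy0 uu0.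
have bg := seq_continuous_bounded_lsc cg; have [_ [M gM]] := bg.
apply: (@Ex_cvg _ _ _ P _ _ M).
- by move=> n; case: (bounded_rv_transition 0 bg (Yy n) (Uu n)).
- by move=> n w; apply: gM; exact: f_viable.
- move=> w; apply: cg; last exact: f_cont.
    by move=> n; exact: f_viable.
  exact: f_viable.
Qed.

Section continuous_subsolutions.
Variables (c : X -> V -> R) (C : R).
Hypotheses (c_cont : forall (y : nat -> X) (u : nat -> V) y1 u1,
    (forall n, Y (y n)) -> Y y1 -> y n @[n --> \oo] --> y1 ->
    u n @[n --> \oo] --> u1 -> c (y n) (u n) @[n --> \oo] --> c y1 u1)
  (c_bound : forall y u, Y y -> `|c y u| <= C).

Local Notation W := (dp_value c 1).

(* A Dini argument: the value iterates are monotone limits of continuous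
   functions, so a continuous strict minorant of [W N.+1] is dominated by the
   Bellman operator at a continuous strict minorant of [W N]. *)
Lemma continuous_minorant_step N phi : seq_continuous Y phi ->
  (forall y, Y y -> phi y < W N.+1 y) ->
  exists phi', [/\ seq_continuous Y phi', forall y, Y y -> phi' y < W N y &
    forall y u, Y y -> U y u -> phi y <= c y u + transition phi' y u].
Proof.
move=> cphi phiW.
have bW : bounded_lsc (W N) by exact: (dp_value_lsc c_cont c_bound ler01).
have [lW [M WM]] := bW.
(* Subtracting a vanishing term makes the minorants strict and keeps them increasing. *)
pose g m y := lip_env Y (W N) M m y - m.+1%:R^-1.
have m0 m : 0 < m.+1%:R^-1 :> R by rewrite invr_gt0 ltr0n.
have cg m : seq_continuous Y (g m).
  move=> y l Yy Yl yl; apply: cvgB; last exact: cvg_cst.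
  by apply: continuous_cvg => //; exact: lip_env_continuous.
have bg m := seq_continuous_bounded_lsc (cg m).
have gW m y : Y y -> g m y < W N y.
  by move=> Yy; rewrite ltrBlDr (le_lt_trans (lip_env_le Y_nonempty WM m Yy))// ltrDl.
apply: contrapT => H.
have /choice[p pP] m : exists p : X * V, [/\ Y p.1, U p.1 p.2 &
    c p.1 p.2 + transition (g m) p.1 p.2 < phi p.1].
  apply: contrapT => np; apply: H; exists (g m); split => // [y Yy|y u Yy Uu].
    exact: gW.
  by rewrite leNgt; apply/negP => lt; apply: np; exists (y, u).
have [|y [Yy [f1 [f1n yl]]]] := compact_seq_compact Y_compact (x := fun m => (p m).1).
  by move=> m; case: (pP m).
have [|u [_ [f2 [f2n ul]]]] := compact_seq_compact V_compact (x := fun m => (p (f1 m)).2).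
  by [].
pose h m := f1 (f2 m).
have hn m : (m <= h m)%N by rewrite (leq_trans (f2n m))// f1n.
have yh : (p (h m)).1 @[m --> \oo] --> y.
  exact: (cvg_subseq f2n yl).
have Yh m : Y (p (h m)).1 by case: (pP (h m)).
have Uh m : U (p (h m)).1 (p (h m)).2 by case: (pP (h m)).
have Uyu : U y u by exact: (U_graph Yh Uh Yy yh ul).
(* With [m] fixed, later minorants dominate [g m], so the inequality at the pairs [p] survives in
   the limit. Letting [m] grow will then contradict [phi < W N.+1]. *)
have key m : c y u + transition (g m) y u <= phi y.
  apply: (@cvg_le_seq _ (fun n => c (p (h (n + m)%N)).1 (p (h (n + m)%N)).2 +
      transition (g m) (p (h (n + m)%N)).1 (p (h (n + m)%N)).2)
    (fun n => phi (p (h (n + m)%N)).1)).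
  - have y1 := cvg_subseq (fun n => leq_addr m n) yh.
    have u1 := cvg_subseq (fun n => leq_addr m n) ul.
    apply: cvgD; first exact: c_cont.
    by apply: seq_continuous_transition.
  - by apply: cphi => //; exact: (cvg_subseq (fun n => leq_addr m n) yh).
  move=> n; have [Y1 U1 /ltW] := pP (h (n + m)%N); apply: le_trans.
  rewrite lerD2l; apply: transition_le => // z Yz; rewrite /g lerB//.
    apply: lip_env_mono => //; apply: leq_trans (hn _); exact: leq_addl.
  rewrite lef_pV2 ?posrE ?ltr0n// ler_nat ltnS; apply: leq_trans (hn _).
  exact: leq_addl.
have : c y u + transition (W N) y u <= phi y.
  apply: (@cvg_le_cst _ (fun m => c y u + transition (g m) y u)) key.
  apply: cvgD; first exact: cvg_cst.
  apply: (@transition_cvg _ _ (M + 1)) => //.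
    move=> m z Yz; rewrite /g (le_trans (ler_normB _ _))// lerD//.
      exact: lip_env_bounded.
    rewrite ger0_norm; last exact: ltW.
    by rewrite invf_le1 ?ltr0n// ler1n.
  move=> z Yz; rewrite -[X in _ --> X]subr0; apply: cvgB; first exact: lip_env_cvg.
  apply/cvgrPdist_lt => e e0; have [K _ KP] := near_infty_natSinv_lt (PosNum e0).
  by exists K => // k /= Kk; rewrite sub0r normrN ger0_norm ?ltW//; exact: KP.
rewrite leNgt => /negP; apply; apply: lt_le_trans (phiW y Yy) _.
have := dp_value_le c_cont c_bound ler01 N Yy Uyu.
by rewrite /stage_cost mul1r.
Qed.

Lemma continuous_subsolution_chain N phi : seq_continuous Y phi ->
  (forall y, Y y -> phi y < W N y) ->
  exists w : nat -> X -> R, [/\ forall t, seq_continuous Y (w t), w N = phi,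
    forall y, Y y -> w 0%N y <= 0 &
    forall t y u, (t < N)%N -> Y y -> U y u ->
      w t.+1 y <= c y u + transition (w t) y u].
Proof.
elim: N phi => [|N IH] phi cphi phiW.
  by exists (fun=> phi); split => // y /phiW/ltW.
have [phi' [cphi' phi'W step]] := continuous_minorant_step cphi phiW.
have [w [cw wN w0 wS]] := IH phi' cphi' phi'W.
exists (fun t => if (t <= N)%N then w t else phi); split => //.
- by move=> t; case: ifP.
- by rewrite ltnn.
move=> t y u; rewrite ltnS leq_eqVlt => /predU1P[->|tN] Yy Uu.
  by rewrite ltnn eqxx /= wN; exact: step.
by rewrite tN orbT; exact: wS.
Qed.

(** Start a chain of subsolutions at the constant [- (e * T%:R)], a strict minorant of [W T]. For
    the average of the chain, [c + transition eta - eta] telescopes to at least the difference of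
    transitions of [w T] and [w 0], divided by [T]; the first is that constant and the second is
    nonpositive. *)
Lemma continuous_subsolution (T : nat) (e : R) : (0 < T)%N ->
  (forall y, Y y -> - (e * T%:R) < W T y) ->
  exists2 eta, seq_continuous Y eta & forall y u, Y y -> U y u ->
    - e <= c y u + transition eta y u - eta y.
Proof.
move=> T0 HW; have Tr : 0 < T%:R :> R by rewrite ltr0n.
have [|w [cw wT w0 wS]] := continuous_subsolution_chain (phi := fun=> - (e * T%:R)) _ HW.
  by move=> y l _ _ _; exact: cvg_cst.
have bw t := seq_continuous_bounded_lsc (cw t).
pose eta y := T%:R^-1 * \sum_(0 <= t < T) w t.+1 y.
exists eta.
  move=> y l Yy Yl yl; apply: cvgMr.
  elim: (T) => [|n IH]; first by under eq_fun do rewrite big_nil; rewrite big_nil; exact: cvg_cst.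
  under eq_fun do rewrite big_nat_recr//=; rewrite big_nat_recr//=.
  by apply: cvgD => //; exact: cw.
move=> y u Yy Uu.
have trE : transition eta y u = T%:R^-1 * \sum_(0 <= t < T) transition (w t.+1) y u.
  have br t : bounded_rv (fun x => w t.+1 (f y u (s 0%N x))).
    exact: bounded_rv_transition.
  by rewrite /transition /eta ExZ ?Ex_sum//; exact: bounded_rv_sum.
have key : \sum_(0 <= t < T) w t.+1 y <=
    T%:R * c y u + \sum_(0 <= t < T) transition (w t) y u.
  rewrite mulr_natl -[X in _ *+ X]subn0 -sumr_const_nat -big_split/= ler_sum_nat//.
  by move=> t /= tT; exact: wS.
have q0 : transition (w 0%N) y u <= 0.
  rewrite -[leRHS](Ex_cst P 0); apply: Ex_le.
  - exact: bounded_rv_transition.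
  - exact: bounded_rv_cst.
  - by move=> x; apply: w0; exact: f_viable.
have qT : transition (w T) y u = - (e * T%:R) by rewrite wT /transition Ex_cst.
rewrite trE /eta -(ler_pM2l Tr) !mulrDr mulrN mulVKf ?gt_eqF// mulrN mulVKf ?gt_eqF//.
rewrite (sum_nat_shift (fun t => transition (w t) y u)) qT; lra.
Qed.

End continuous_subsolutions.

Section correctors.
Variables (k : X -> V -> R) (C : R) (v : X -> R) (g eta : nat -> X -> R) (M : R).
Hypotheses (k_cont : forall (y : nat -> X) (u : nat -> V) y1 u1,
    (forall n, Y (y n)) -> Y y1 -> y n @[n --> \oo] --> y1 ->
    u n @[n --> \oo] --> u1 -> k (y n) (u n) @[n --> \oo] --> k y1 u1)
  (k_bound : forall y u, Y y -> `|k y u| <= C)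
  (v_cont : seq_continuous Y v)
  (g_lsc : forall m, seq_lsc Y (g m)) (g_bound : forall m, bounded_on Y (g m) M)
  (eta_lsc : forall m, bounded_lsc (eta m))
  (g_eta : forall m y u, Y y -> U y u ->
    transition (g m) y u + eta m y <= k y u + transition (eta m) y u)
  (g_v : forall y, Y y -> g m y @[m --> \oo] --> v y)
  (v_sub : forall y u, Y y -> U y u -> v y <= transition v y u).

Let l y u := k y u - v y.

Let bv : bounded_lsc v := seq_continuous_bounded_lsc v_cont.
Let bg m : bounded_lsc (g m). Proof. by split; [|exists M]. Qed.

Let l_cont (y : nat -> X) (u : nat -> V) y1 u1 :
    (forall n, Y (y n)) -> Y y1 -> y n @[n --> \oo] --> y1 ->
    u n @[n --> \oo] --> u1 -> l (y n) (u n) @[n --> \oo] --> l y1 u1.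
Proof. by move=> Yy Yy1 yy1 uu1; apply: cvgB; [exact: k_cont|exact: v_cont]. Qed.

Let l_bound : exists C', forall y u, Y y -> `|l y u| <= C'.
Proof.
have [_ [Mv vM]] := bv; exists (C + Mv) => y u Yy.
by rewrite (le_trans (ler_normB _ _))// lerD ?vM ?k_bound.
Qed.

(** One telescoping step. The corrector inequality involves [transition (g m)], so [v_sub] moves [v]
    to time [t.+1] as well. *)
Lemma corrector_trajectory (pi : nat -> X -> V) (y0 : X) m t :
  control_plans Y U pi -> Y y0 ->
  Ex P (fun w => eta m (state f s pi y0 t w)) - mean_cost l pi y0 t <=
  Ex P (fun w => v (state f s pi y0 t.+1 w)) - Ex P (fun w => g m (state f s pi y0 t.+1 w))
    + Ex P (fun w => eta m (state f s pi y0 t.+1 w)).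
Proof.
move=> pi_plan Yy0; have [C' lC'] := l_bound.
have [b1 ->] := markov_property pi_plan Yy0 t bv.
have [b2 ->] := markov_property pi_plan Yy0 t (bg m).
have [b3 ->] := markov_property pi_plan Yy0 t (eta_lsc m).
have b4 := bounded_rv_state pi_plan Yy0 t (eta_lsc m).
have b5 := bounded_rv_stage l_cont lC' pi_plan Yy0 t.
rewrite /mean_cost -!ExB// -ExD//; last exact: bounded_rvB.
apply: Ex_le; first exact: bounded_rvB.
  by apply: bounded_rvD => //; exact: bounded_rvB.
move=> w; set y := state _ _ _ _ _ _; set u := control _ _ _ _ _ _.
have Yy : Y y by exact: state_in.
have Uu : U y u by exact: control_in.
by have := g_eta m Yy Uu; have := v_sub Yy Uu; rewrite /l; lra.
Qed.

(* If the value iterates of the cost [k - v] stayed below [- e T] for all [T],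
   then a finitely additive mean of the occupation measures of optimal
   trajectories would give [v - g m] mean at least [e] for every [m],
   contradicting the convergence of [g] to [v]. *)
Lemma value_iterates_liminf (e : R) : 0 < e -> exists2 T, (0 < T)%N &
  forall y, Y y -> - (e * T%:R) <= dp_value l 1 T y.
Proof.
move=> e0; apply: contrapT => H; have [C' lC'] := l_bound.
have /choice[y0 y0P] T : exists y, Y y /\ dp_value l 1 T.+1 y < - (e * T.+1%:R).
  apply: contrapT => ny; apply: H; exists T.+1 => // y Yy.
  by rewrite leNgt; apply/negP => lt; apply: ny; exists y.
have /choice[pi piP] T : exists pi, control_plans Y U pi /\
    \sum_(0 <= t < T.+1) mean_cost l pi (y0 T) t < - (e * T.+1%:R).
  have [pi pi_plan piE] := dp_value_attained l_cont lC' ler01 T.+1.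
  exists pi; split => //; have [Yy] := y0P T; rewrite -(piE _ Yy).
  by under eq_bigr do rewrite expr1n mul1r.
pose z T t := state f s (pi T) (y0 T) t.
have Yz T t w : Y (z T t w).
  by apply: state_in => //; [case: (piP T)|case: (y0P T)].
(* A lattice containing the lower semicontinuous functions and their differences, on which all the
   occupation means make sense. *)
pose B (h : X -> R) := (exists N, bounded_on Y h N) /\
  forall T t, bounded_rv (fun w => h (z T t w)).
have B_lsc h : bounded_lsc h -> B h.
  move=> bh; split; first by case: bh.
  by move=> T t; apply: bounded_rv_state => //; [case: (piP T)|case: (y0P T)].
have B_cst a : B (fun=> a).
  split; last by move=> T t; exact: bounded_rv_cst.
  by exists `|a|.
have B_add h h' : B h -> B h' -> B (fun x => h x + h' x).
  move=> [[N hN] bh] [[N' hN'] bh']; split; last by move=> T t; exact: bounded_rvD.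
  by exists (N + N') => y Yy; rewrite (le_trans (ler_normD _ _))// lerD ?hN ?hN'.
have B_opp h : B h -> B (fun x => - h x).
  move=> [[N hN] bh]; split; first by exists N => y Yy; rewrite normrN hN.
  by move=> T t; under eq_fun do rewrite -mulN1r; exact: bounded_rvZ.
have B_max h h' : B h -> B h' -> B (fun x => Num.max (h x) (h' x)).
  move=> [[N hN] bh] [[N' hN'] bh']; split; last by move=> T t; exact: bounded_rv_max.
  exists (Num.max N N') => y Yy; rewrite le_max.
  by case: (leP (h y)) => _; rewrite ?hN ?hN' ?orbT.
have B_min h h' : B h -> B h' -> B (fun x => Num.min (h x) (h' x)).
  move=> Bh Bh'; under eq_fun do rewrite -[Num.min _ _]opprK oppr_min.
  by apply: (B_opp); apply: B_max; exact: B_opp.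
(* Occupation over times 1 to [T.+1], the shift coming from [corrector_trajectory]. *)
pose J T (h : X -> R) := T.+1%:R^-1 * \sum_(0 <= t < T.+1) Ex P (fun w => h (z T t.+1 w)).
have Jpos T : normalized_positive Y B (J T).
  have T0 : 0 < T.+1%:R :> R by rewrite ltr0n.
  split.
  - move=> a; rewrite /J; under eq_bigr do rewrite Ex_cst.
    by rewrite sumr_const_nat subn0 -(mulr_natl a) mulKf// gt_eqF.
  - move=> h h' [_ bh] [_ bh']; rewrite /J -mulrDr -big_split/=.
    by congr (_ * _); apply: eq_bigr => t _; rewrite ExD.
  - move=> h h' [_ bh] [_ bh'] hh'; rewrite /J ler_pM2l ?invr_gt0//.
    by apply: ler_sum_nat => t _; apply: Ex_le => // w; exact: hh'.
pose q m y := Num.max (v y - g m y) 0.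
have Bvg m : B (fun y => v y - g m y).
  by apply: B_add; [exact: B_lsc|apply: B_opp; exact: B_lsc].
have Bq m : B (q m) by apply: B_max.
have [_ [Mv vM]] := bv.
have qM m y : Y y -> q m y <= Mv + M.
  move=> Yy; have := vM y Yy; have := g_bound m Yy; rewrite !ler_norml.
  by move=> /andP[? ?] /andP[? ?]; rewrite ge_max; apply/andP; split; lra.
have e2 : 0 < e / 2 by rewrite divr_gt0.
have q_closed m : closed (Y `&` [set y | e / 2 / 4 <= q m y]).
  apply: seq_closed => y y1 Yq yy1.
  have Yy n : Y (y n) by case: (Yq n).
  have Yy1 : Y y1 by exact: (closed_seq Y_closed Yy yy1).
  split => //=; rewrite le_max; apply/orP; left.
  have gm n : g m (y n) <= v (y n) - e / 2 / 4.
    have [_ /=] := Yq n; rewrite le_max => /orP[|]; first by lra.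
    by move: e2; lra.
  have vy := v_cont Yy Yy1 yy1.
  suff : g m y1 <= v y1 - e / 2 / 4 by lra.
  (* [seq_lsc] asks for a constant bound, so [v (y n)] is replaced by its limit up to [a]. *)
  apply/ler_addgt0Pl => a a0.
  have /cvgrPdist_le/(_ a a0)[N _ NP] := vy.
  apply: (@g_lsc m (fun n => y (n + N)%N) y1) => //.
    move=> n; apply: le_trans (gm _) _.
    have := NP (n + N)%N (leq_addl _ _) => /=; rewrite ler_distl => /andP[+ _].
    by lra.
  exact: (cvg_subseq (fun n => leq_addr N n) yy1).
(* The end terms of the telescoping cost at most [2 * Me], which for large horizons is half of the
   excess [e * T.+1]. *)
have Jq m : \forall T \near \oo, e / 2 <= J T (q m).
  have [_ [Me eM]] := eta_lsc m.
  near=> T.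
  have T0 : 0 < T.+1%:R :> R by rewrite ltr0n.
  have pi_plan : control_plans Y U (pi T) by case: (piP T).
  have Yy0 : Y (y0 T) by case: (y0P T).
  have [Jc Ja Jle] := Jpos T.
  apply: (@le_trans _ _ (J T (fun y => v y - g m y))); last first.
    by apply: Jle => // y _; rewrite le_max lexx.
  have eB t : `|Ex P (fun w => eta m (z T t w))| <= Me.
    by apply: Ex_norm_le => [|w]; [case: (B_lsc _ (eta_lsc m))|exact: eM].
  have tele n : Ex P (fun w => eta m (z T 0%N w)) - \sum_(0 <= t < n) mean_cost l (pi T) (y0 T) t <=
     \sum_(0 <= t < n) Ex P (fun w => v (z T t.+1 w) - g m (z T t.+1 w)) +
     Ex P (fun w => eta m (z T n w)).
    elim: n => [|n IH]; first by rewrite !big_nil subr0 add0r.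
    rewrite !big_nat_recr//=.
    rewrite (ExB P ((B_lsc _ bv).2 T n.+1) ((B_lsc _ (bg m)).2 T n.+1)).
    by move: IH (corrector_trajectory m n pi_plan Yy0); rewrite /z; lra.
  rewrite /J -(ler_pM2l T0) mulVKf ?gt_eqF//.
  have := tele T.+1; have := eB 0%N; have := eB T.+1; have [_] := piP T.
  have : 2 * Me <= T.+1%:R * (e / 2).
    rewrite -ler_pdivrMr//; near: T; have [N _ NP] := nbhs_infty_ger (2 * Me / (e / 2)).
    by exists N => // n /= Nn; apply: le_trans (NP n Nn) _; rewrite ler_nat.
  rewrite !ler_norml; set a := \sum_(_ <= _ < _) mean_cost _ _ _ _.
  by move=> ? ? /andP[? ?] /andP[? ?] ?; lra.
have [y Yy yP] := @finitely_additive_fatou_seq R X Y B (compact_seq_compact Y_compact)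
  (fun h Bh => Bh.1) B_cst B_add B_max B_min J q (Mv + M) (e / 2) Jpos Bq qM
  q_closed e2 Jq.
have e8 : 0 < e / 2 / 8 by rewrite divr_gt0.
have /cvgrPdist_lt/(_ _ e8)[N _ NP] := g_v Yy.
have [m Nm] := yP N; have /= := NP m Nm; rewrite ltr_norml => /andP[_ h1].
by rewrite le_max => /orP[]; move: e2 e8; lra.
Unshelve. all: by end_near. Qed.

Theorem corrector_exists (e : R) : 0 < e -> exists2 eta', seq_continuous Y eta' &
  forall y u, Y y -> U y u -> - e <= k y u - v y + transition eta' y u - eta' y.
Proof.
move=> e0; have [C' lC'] := l_bound.
(* Half of [e] is given up to make the lower bound strict, as the continuous minorants require. *)
have [T T0 HT] := value_iterates_liminf (e := e / 2) (divr_gt0 e0 (ltr0Sn _ 1)).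
apply: (continuous_subsolution l_cont lC' T0) => y Yy.
apply: lt_le_trans (HT y Yy); rewrite ltrN2 ltr_pM2r ?ltr0n//.
by rewrite ltr_pdivrMr// ltr_pMr// ltr1n.
Qed.

End correctors.

(** * Duality *)

(** Turns closed sublevel sets into eventual lower bounds, which, unlike the former, can be
    added. *)
Lemma seq_lsc_near g (y : nat -> X) l a : seq_lsc Y g -> (forall n, Y (y n)) -> Y l ->
  y n @[n --> \oo] --> l -> a < g l -> exists N, forall n, (N <= n)%N -> a < g (y n).
Proof.
move=> lg Yy Yl yl al; apply: contrapT => H.
have /choice[phi phiP] N : exists n, (N <= n)%N /\ g (y n) <= a.
  apply: contrapT => nN; apply: H; exists N => n Nn; rewrite ltNge; apply/negP => ga.
  by apply: nN; exists n.
have : g l <= a.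
  apply: (lg (fun n => y (phi n)) l) => //; first by move=> n; case: (phiP n).
  by apply: (cvg_subseq _ yl) => n; case: (phiP n).
by rewrite leNgt al.
Qed.

Lemma bounded_lscD g h : bounded_lsc g -> bounded_lsc h -> bounded_lsc (fun y => g y + h y).
Proof.
move=> [lg [M gM]] [lh [N hN]]; split; last first.
  by exists (M + N) => y Yy; rewrite (le_trans (ler_normD _ _))// lerD ?gM ?hN.
move=> y l c Yy Yl H yl; rewrite leNgt; apply/negP => cl.
pose a := (g l + h l - c) / 2.
have a0 : 0 < a by rewrite divr_gt0// subr_gt0.
have [|N1 N1P] := @seq_lsc_near g y l (g l - a) lg Yy Yl yl; first by rewrite ltrBlDr ltrDl.
have [|N2 N2P] := @seq_lsc_near h y l (h l - a) lh Yy Yl yl; first by rewrite ltrBlDr ltrDl.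
have := N1P _ (leq_maxl N1 N2); have := N2P _ (leq_maxr N1 N2).
by have := H (maxn N1 N2); rewrite /a; lra.
Qed.

Lemma bounded_lscZ a g : 0 < a -> bounded_lsc g -> bounded_lsc (fun y => a * g y).
Proof.
move=> a0 [lg [M gM]]; split; last first.
  by exists (a * M) => y Yy; rewrite normrM gtr0_norm// ler_pM2l// gM.
move=> y l c Yy Yl H yl; rewrite -ler_pdivlMl//; apply: (lg y l) => // n.
by rewrite ler_pdivlMl.
Qed.

Lemma bounded_lsc_sum (g : nat -> X -> R) n : (forall i, bounded_lsc (g i)) ->
  bounded_lsc (fun y => \sum_(0 <= i < n) g i y).
Proof.
move=> bg; elim: n => [|n IH].
  under eq_fun do rewrite big_nil.
  by split => [y l r _ _ /(_ 0%N)//|]; exists 0 => y _; rewrite normr0.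
by under eq_fun do rewrite big_nat_recr//=; exact: bounded_lscD.
Qed.

Lemma transitionZ a g y u : bounded_lsc g -> Y y -> U y u ->
  transition (fun z => a * g z) y u = a * transition g y u.
Proof. by move=> bg Yy Uu; rewrite /transition ExZ//; exact: bounded_rv_transition. Qed.

Lemma transition_sum (g : nat -> X -> R) n y u : (forall i, bounded_lsc (g i)) ->
  Y y -> U y u -> transition (fun z => \sum_(0 <= i < n) g i z) y u =
    \sum_(0 <= i < n) transition (g i) y u.
Proof.
by move=> bg Yy Uu; rewrite /transition Ex_sum// => i; exact: bounded_rv_transition.
Qed.

Section duality.
Variables (k : X -> V -> R) (C : R).
Hypotheses (k_cont : forall (y : nat -> X) (u : nat -> V) y1 u1,
    (forall n, Y (y n)) -> Y y1 -> y n @[n --> \oo] --> y1 ->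
    u n @[n --> \oo] --> u1 -> k (y n) (u n) @[n --> \oo] --> k y1 u1)
  (k_bound : forall y u, Y y -> `|k y u| <= C).

Local Notation W := (dp_value k).

Definition seq_dual_feasible (y0 : X) (mu : R) (psi eta : X -> R) :=
  [/\ seq_continuous Y psi, seq_continuous Y eta &
      forall y u, Y y -> U y u ->
        0 <= k y u + (psi y0 - psi y) + transition eta y u - eta y - mu /\
        psi y <= transition psi y u].

Lemma dual_feasibleP y0 mu psi eta :
  dual_feasible P Y U f k s y0 mu psi eta <-> seq_dual_feasible y0 mu psi eta.
Proof.
have tE g y u : seq_continuous Y g -> Y y -> U y u ->
    ('E_P[fun w => g (f y u (s 0%N w))] = (transition g y u)%:E)%E.
  move=> cg Yy Uu; rewrite expectationE//; apply: bounded_rv_transition => //.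
  exact: seq_continuous_bounded_lsc.
split=> [[cp ce H]|[cp ce H]].
  have cp' : seq_continuous Y psi by move=> y l Yy Yl; exact: within_continuous_seq.
  have ce' : seq_continuous Y eta by move=> y l Yy Yl; exact: within_continuous_seq.
  split => // y u Yy Uu; have [] := H y u (conj Yy Uu).
  by rewrite !tE// -EFinD -!EFinB !lee_fin subr_ge0 => ? ?; split => //; lra.
split => [||y u [/= Yy Uu]].
- by apply: seq_within_continuous => x l Yx Yl; exact: cp.
- by apply: seq_within_continuous => x l Yx Yl; exact: ce.
have [h1 h2] := H y u Yy Uu.
by rewrite !tE// -EFinD -!EFinB !lee_fin subr_ge0; split => //; lra.
Qed.

(** In the recursion [transition eta] is needed in full but returned only with weight [b]; the
    missing [1 - b] part costs [(1 - b) * Me]. Added to the inherited [b * Me], this keeps the error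
    at [Me] for every horizon and discount. *)
Lemma dual_lower_bound b y0 mu psi eta Me N y : 0 <= b <= 1 -> Y y ->
  seq_dual_feasible y0 mu psi eta -> bounded_on Y eta Me ->
  geometric_sum b N * (mu - psi y0 + psi y) + eta y - Me <= W b N y.
Proof.
move=> /andP[b0 b1] + [cp ce H] eM; elim: N y => [|N IH] y Yy.
  rewrite /geometric_sum big_nil mul0r add0r /=.
  by have := eM y Yy; rewrite ler_norml => /andP[_ ?]; lra.
have bW : bounded_lsc (W b N) by exact: (dp_value_lsc k_cont k_bound b0).
have [sg [mg _]] := stage_cost_selector k_cont k_bound b0 bW.
have [Us _] := mg y Yy.
have -> : W b N.+1 y = stage_cost k b (W b N) y (sg y) by exact: bellman_argmin (mg y Yy).
rewrite /stage_cost geometric_sumS.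
have bp := seq_continuous_bounded_lsc cp; have be := seq_continuous_bounded_lsc ce.
have tl : geometric_sum b N * (mu - psi y0 + transition psi y (sg y)) +
    transition eta y (sg y) - Me <= transition (W b N) y (sg y).
  have brp := bounded_rv_transition 0 bp Yy Us.
  have bre := bounded_rv_transition 0 be Yy Us.
  have -> : geometric_sum b N * (mu - psi y0 + transition psi y (sg y)) +
      transition eta y (sg y) - Me =
    Ex P (fun w => (geometric_sum b N * psi (f y (sg y) (s 0%N w)) + eta (f y (sg y) (s 0%N w)))
      + (geometric_sum b N * (mu - psi y0) - Me)).
    by rewrite Ex_affine// /transition; ring.
  apply: Ex_le.
  - apply: bounded_rvD; last exact: bounded_rv_cst.
    by apply: bounded_rvD => //; exact: bounded_rvZ.
  - exact: bounded_rv_transition.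
  - by move=> w; have := IH _ (f_viable (s 0%N w) Yy Us); lra.
have [h1 h2] := H y (sg y) Yy Us.
have eM' : transition eta y (sg y) <= Me.
  by have := transition_bounded be eM Yy Us; rewrite ler_norml => /andP[].
have a0 : 0 <= geometric_sum b N.
  by apply: sumr_ge0 => i _; rewrite exprn_ge0.
move: tl h1 h2 eM' a0; move: (geometric_sum b N) (transition psi y (sg y))
  (transition eta y (sg y)) (transition (W b N) y (sg y)) => a tp te tW tl h1 h2 eM' a0.
have := ler_wpM2l b0 tl; have := ler_wpM2l (mulr_ge0 b0 a0) h2.
have b1' : 0 <= 1 - b by rewrite subr_ge0.
by have := ler_wpM2l b1' eM'; nra.
Qed.

Section approximation.
Variables (v : X -> R) (g eta : nat -> X -> R) (delta : nat -> R) (M : R).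

(** The common core of both parts: [delta] is the defect of [g m] as a subsolution of
    [g <= transition g], and [r] the error of weak duality at stage [m]. *)
Theorem duality_of_approximation :
  seq_continuous Y v -> (forall m, seq_lsc Y (g m)) -> (forall m, bounded_on Y (g m) M) ->
  (forall m, bounded_lsc (eta m)) ->
  (forall m y u, Y y -> U y u ->
    transition (g m) y u + eta m y <= k y u + transition (eta m) y u) ->
  (forall y, Y y -> g m y @[m --> \oo] --> v y) ->
  delta m @[m --> \oo] --> 0 ->
  (forall m y u, Y y -> U y u -> g m y <= transition (g m) y u + delta m) ->
  (forall y0 mu psi eta', Y y0 -> seq_dual_feasible y0 mu psi eta' ->
    exists2 r : nat -> R, r m @[m --> \oo] --> 0 & forall m, mu - r m <= g m y0) ->
  forall y0, Y y0 -> (v y0)%:E = dual_value P Y U f k s y0.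
Proof.
move=> cv lg gM leta g_eta g_v delta0 g_sub g_weak y0 Yy0.
have bg m : bounded_lsc (g m) by split; [|exists M].
have v_sub y u : Y y -> U y u -> v y <= transition v y u.
  move=> Yy Uu; apply: (cvg_le_seq (g_v y Yy) _ (fun m => g_sub m y u Yy Uu)).
  rewrite -[X in _ --> X]addr0; apply: cvgD => //.
  exact: (transition_cvg bg gM g_v Yy Uu).
apply/eqP; rewrite eq_le; apply/andP; split; last first.
  apply: ge_ereal_sup => _ [mu [psi [eta' /dual_feasibleP feas]] <-].
  rewrite lee_fin; have [r r0 rP] := g_weak y0 mu psi eta' Yy0 feas.
  apply: (cvg_le_seq _ (g_v y0 Yy0) rP).
  by rewrite -[X in _ --> X]subr0; apply: cvgB => //; exact: cvg_cst.
apply/lee_subgt0Pr => e e0; rewrite -EFinB; apply: ereal_sup_ubound.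
have [eta' ceta' H] := corrector_exists k_cont k_bound cv lg gM leta g_eta g_v v_sub e0.
exists (v y0 - e) => //; exists v, eta'; apply/dual_feasibleP; split => // y u Yy Uu.
by split; [have := H y u Yy Uu; lra|exact: v_sub].
Qed.

End approximation.

Lemma expected_plan_cost b pi y0 T : control_plans Y U pi -> Y y0 ->
  ('E_P[fun w => (\sum_(0 <= t < T) b ^+ t *
     k (state f s pi y0 t w) (control f s pi y0 t w))%R] =
   (\sum_(0 <= t < T) b ^+ t * mean_cost k pi y0 t)%:E)%E.
Proof.
move=> pi_plan Yy0; rewrite expectationE; last first.
  exact: (bounded_rv_plan_cost _ k_cont k_bound pi_plan Yy0).
by rewrite (Ex_plan_cost _ k_cont k_bound).
Qed.

Lemma finite_horizon_value T y0 : Y y0 ->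
  v_ P Y U f k s T y0 = (T%:R^-1 * W 1 T y0)%:E.
Proof.
move=> Yy0; rewrite /v_ EFinM; congr (_ * _)%E.
have sumE pi : (fun w => \sum_(0 <= t < T) k (state f s pi y0 t w) (control f s pi y0 t w)) =
    (fun w => \sum_(0 <= t < T) 1 ^+ t * k (state f s pi y0 t w) (control f s pi y0 t w)).
  by apply/funext => w; apply: eq_bigr => t _; rewrite expr1n mul1r.
apply/eqP; rewrite eq_le; apply/andP; split.
  have [pi pi_plan piE] := dp_value_attained k_cont k_bound ler01 T.
  apply: ge_ereal_inf; eexists; first by exists pi.
  by rewrite sumE expected_plan_cost// piE.
apply/ereal_infP => _ [pi pi_plan <-]; rewrite sumE expected_plan_cost// lee_fin.
exact: (dp_value_lower k_cont k_bound ler01).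
Qed.

(** Truncation after [N] stages changes the cost of every plan by at most [C * (1 - e) ^+ N / e],
    uniformly in the plan, so infima differ by no more; the factor [e] cancels the denominator. *)
Lemma discounted_value_bounds e N y0 : 0 < e <= 1 -> Y y0 ->
  ((e * W (1 - e) N y0 - C * (1 - e) ^+ N)%:E <= h_ P Y U f k s e y0)%E /\
  (h_ P Y U f k s e y0 <= (e * W (1 - e) N y0 + C * (1 - e) ^+ N)%:E)%E.
Proof.
move=> /andP[e0 e1] Yy0; set b := 1 - e.
have b0 : 0 <= b by rewrite subr_ge0.
have b1 : b < 1 by rewrite gtrBl.
have eb : 1 - b = e by rewrite /b opprB addrC subrK.
pose D := C * b ^+ N / e.
have eD : e * D = C * b ^+ N by rewrite /D mulrC divfK// gt_eqF.
have planE pi : control_plans Y U pi -> exists2 r : R,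
    'E_P[fun w => limn (series (fun t => b ^+ t *
        k (state f s pi y0 t w) (control f s pi y0 t w))%R)]%E = r%:E &
    `|r - \sum_(0 <= t < N) b ^+ t * mean_cost k pi y0 t| <= D.
  move=> pi_plan; pose a w t := k (state f s pi y0 t w) (control f s pi y0 t w).
  have aC w t : `|a w t| <= C by apply: k_bound; exact: state_in.
  have tail w := discounted_tail (a := a w) (introT andP (conj b0 b1)) (aC w).
  have bS n : bounded_rv (fun w => \sum_(0 <= t < n) b ^+ t * a w t).
    exact: (bounded_rv_plan_cost _ k_cont k_bound pi_plan Yy0).
  have bL : bounded_rv (fun w => limn (series (fun t => b ^+ t * a w t))).
    split.
      apply: (@measurable_fun_cvg _ _ _ setT (fun n w => \sum_(0 <= t < n) b ^+ t * a w t)).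
        by move=> n; case: (bS n).
      by move=> w _; have [] := tail w.
    exists (C * b ^+ 0 / (1 - b)) => w; have [_ /(_ 0%N)] := tail w.
    by rewrite big_nil subr0.
  exists (Ex P (fun w => limn (series (fun t => b ^+ t * a w t)))).
    by rewrite expectationE.
  rewrite -(Ex_plan_cost b k_cont k_bound pi_plan Yy0) -ExB//.
  apply: Ex_norm_le; first exact: bounded_rvB.
  by move=> w; have [_ /(_ N)] := tail w; rewrite eb.
have e0' : (0 <= e%:E)%E by rewrite lee_fin ltW.
rewrite /h_ -/b; split.
  rewrite (_ : (_ - _)%:E = (e%:E * (W b N y0 - D)%:E)%E); last first.
    by rewrite -EFinM mulrBr eD.
  apply: lee_wpmul2l => //.
  apply/ereal_infP => _ [pi pi_plan <-]; have [r -> rD] := planE pi pi_plan.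
  rewrite lee_fin; have := dp_value_lower k_cont k_bound b0 pi_plan Yy0 N.
  by move: rD; rewrite ler_norml => /andP[? ?] ?; lra.
rewrite (_ : (_ + _)%:E = (e%:E * (W b N y0 + D)%:E)%E); last first.
  by rewrite -EFinM mulrDr eD.
apply: lee_wpmul2l => //.
have [pi pi_plan piE] := dp_value_attained k_cont k_bound b0 N.
apply: ge_ereal_inf; eexists; first by exists pi.
have [r -> rD] := planE pi pi_plan.
by rewrite lee_fin; move: rD; rewrite (piE _ Yy0) ler_norml => /andP[? ?]; lra.
Qed.

Lemma cost_bound_ge0 : 0 <= C.
Proof.
have [y Yy] := Y_nonempty; have [u _] := U_nonempty Yy.
exact: le_trans (k_bound u Yy).
Qed.

Lemma cvg_inv_cst (c : R) : c * m.+1%:R^-1 @[m --> \oo] --> 0.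
Proof. by rewrite -[X in _ --> X](mulr0 c); apply: cvgMr; exact: cvg_harmonic. Qed.

Theorem average_duality (v : X -> R) :
  (forall y0, Y y0 -> v_ P Y U f k s T y0 @[T --> \oo] --> (v y0)%:E) ->
  seq_continuous Y v -> forall y0, Y y0 -> (v y0)%:E = dual_value P Y U f k s y0.
Proof.
move=> v_lim cv.
have bW n : bounded_lsc (W 1 n) := dp_value_lsc k_cont k_bound ler01 n.
have n0 m : 0 < m.+1%:R :> R by rewrite ltr0n.
have geo n : geometric_sum 1 n = n%:R :> R.
  elim: n => [|n IH]; first by rewrite /geometric_sum big_nil.
  by rewrite geometric_sumS IH mul1r -natr1 addrC.
have bI m : 0 < m.+1%:R^-1 :> R by rewrite invr_gt0.
(* In [2 * C], one [C] comes from adding a stage and one from the cost of the first stage. *)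
apply: (@duality_of_approximation v (fun m y => m.+1%:R^-1 * W 1 m.+1 y)
  (fun m y => m.+1%:R^-1 * \sum_(0 <= t < m.+1) W 1 t.+1 y)
  (fun m => 2 * C * m.+1%:R^-1) C) => //.
- by move=> m; case: (bounded_lscZ (bI m) (bW m.+1)).
- move=> m y Yy; rewrite normrM gtr0_norm// ler_pdivrMl//.
  by have := dp_value_bounded k_cont k_bound ler01 m.+1 Yy; rewrite geo.
- by move=> m; apply: bounded_lscZ => //; exact: bounded_lsc_sum.
- move=> m y u Yy Uu; rewrite !transitionZ//; last exact: bounded_lsc_sum.
  rewrite transition_sum// -(ler_pM2l (n0 m)) !mulrDr !mulVKf ?gt_eqF//.
  (* The end term of the shift, [transition (W 1 m.+1)], is what [transition (g m)] has to
     absorb. *)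
  rewrite (sum_nat_shift (fun t => transition (W 1 t) y u)).
  have -> : transition (W 1 0) y u = 0 by exact: Ex_cst.
  have : \sum_(0 <= t < m.+1) W 1 t.+1 y <=
      m.+1%:R * k y u + \sum_(0 <= t < m.+1) transition (W 1 t) y u.
    rewrite mulr_natl -[X in _ *+ X]subn0 -sumr_const_nat -big_split/= ler_sum_nat//.
    move=> t _; have := dp_value_le k_cont k_bound ler01 t Yy Uu.
    by rewrite /stage_cost mul1r.
  by lra.
- move=> y Yy; have : (fine \o (fun T => v_ P Y U f k s T y)) T @[T --> \oo] --> v y.
    exact: fine_cvg (v_lim y Yy).
  move=> /(cvg_subseq (phi := succn) leqnSn).
  rewrite (_ : (fun n => _) = fun m => m.+1%:R^-1 * W 1 m.+1 y)//.
  by apply/funext => m; rewrite /= finite_horizon_value.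
- exact: cvg_inv_cst.
- move=> m y u Yy Uu; rewrite transitionZ// -(ler_pM2l (n0 m)) mulrDr !mulVKf ?gt_eqF//.
  rewrite [_ * (_ * _^-1)]mulrC divfK ?gt_eqF//.
  have := dp_value_step k_cont k_bound ler01 m.+1 Yy.
  have := dp_value_le k_cont k_bound ler01 m.+1 Yy Uu.
  have := k_bound u Yy; rewrite ler_norml /stage_cost mul1r expr1n mul1r => /andP[? ?] ? ?.
  by lra.
move=> y0 mu psi eta Yy0 feas; have [_ ceta _] := feas.
have [_ [Me eM]] := seq_continuous_bounded_lsc ceta.
(* One [Me] from [dual_lower_bound], the other from [eta y0]. *)
exists (fun m => 2 * Me * m.+1%:R^-1); first exact: cvg_inv_cst.
move=> m; rewrite -(ler_pM2l (n0 m)) mulrBr mulVKf ?gt_eqF// [_ * (_ * _^-1)]mulrC divfK ?gt_eqF//.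
have b01 : 0 <= (1 : R) <= 1 by rewrite ler01 lexx.
have := dual_lower_bound m.+1 b01 Yy0 feas eM; rewrite geo subrK.
by have := eM y0 Yy0; rewrite ler_norml => /andP[? ?]; lra.
Qed.

Theorem discounted_duality (h : X -> R) :
  (forall y0, Y y0 -> h_ P Y U f k s eps y0 @[eps --> 0^'+] --> (h y0)%:E) ->
  seq_continuous Y h -> forall y0, Y y0 -> (h y0)%:E = dual_value P Y U f k s y0.
Proof.
move=> h_lim ch; have C0 := cost_bound_ge0.
(* [m.+2] keeps the discount factor [1 - e m] positive. *)
pose e m : R := m.+2%:R^-1.
have e0 m : 0 < e m by rewrite invr_gt0 ltr0n.
have e1 m : e m < 1 by rewrite invf_lt1 ?ltr0n// ltr1n.
have eI m : e m <= m.+1%:R^-1 by rewrite lef_pV2 ?posrE ?ltr0n// ler_nat.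
pose b m := 1 - e m.
have b0 m : 0 <= b m by rewrite subr_ge0 ltW.
have b1 m : b m <= 1 by rewrite gerBl ltW.
have bE m : 1 - b m = e m by rewrite /b opprB addrC subrK.
(* The truncation horizon is tied to the discount so that truncation errors vanish with [m]. *)
have /choice[N NP] m : exists N, b m ^+ N <= m.+1%:R^-1.
  have i0 : 0 < m.+1%:R^-1 :> R by rewrite invr_gt0 ltr0n.
  have bl : `|b m| < 1 by rewrite ger0_norm// gtrBl.
  have /cvgrPdist_le/(_ _ i0)[K _ /(_ K (leqnn _)) /=] := cvg_expr bl.
  by rewrite sub0r normrN ger0_norm ?exprn_ge0// => H; exists K.
have bN0 m : 0 <= b m ^+ N m by rewrite exprn_ge0.
have geo m n : e m * geometric_sum (b m) n = 1 - b m ^+ n.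
  elim: n => [|n IH]; first by rewrite /geometric_sum big_nil mulr0 expr0 subrr.
  by rewrite geometric_sumS mulrDr mulrCA IH mulr1 exprS -bE; ring.
pose w m := W (b m) (N m).
have bw m : bounded_lsc (w m) := dp_value_lsc k_cont k_bound (b0 m) (N m).
have ew m y : Y y -> `|e m * w m y| <= C.
  move=> Yy; rewrite normrM gtr0_norm//.
  have := dp_value_bounded k_cont k_bound (b0 m) (N m) Yy.
  rewrite -(ler_pM2l (e0 m)) mulrA geo => /le_trans; apply.
  by rewrite ler_piMl// gerBl.
have tg m y u : Y y -> U y u -> transition (fun z => e m * w m z - C * b m ^+ N m) y u =
    e m * transition (w m) y u - C * b m ^+ N m.
  by move=> Yy Uu; rewrite transition_add_cst ?transitionZ//; exact: bounded_lscZ.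
have step m y u : Y y -> U y u ->
    w m y <= k y u + b m * transition (w m) y u + b m ^+ N m * C.
  move=> Yy Uu; have := dp_value_step k_cont k_bound (b0 m) (N m) Yy.
  have := dp_value_le k_cont k_bound (b0 m) (N m) Yy Uu; rewrite /stage_cost -/(w m).
  by lra.
(* Subtracting [C * b m ^+ N m] absorbs the defect of [w m] in the discounted Bellman inequality, so
   [w m] is an exact corrector. The three [C] in the defect bound the stage cost,
   [e m * transition (w m)] and the truncation error. *)
apply: (@duality_of_approximation h (fun m y => e m * w m y - C * b m ^+ N m) w
  (fun m => 3 * C * m.+1%:R^-1) (2 * C)) => //.
- by move=> m; case: (bounded_lsc_add_cst (- (C * b m ^+ N m)) (bounded_lscZ (e0 m) (bw m))).
- move=> m y Yy; rewrite (le_trans (ler_normB _ _))// mulr_natl mulr2n lerD ?ew//.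
  by rewrite ger0_norm ?mulr_ge0// ler_piMr// exprn_ile1.
- by move=> m y u Yy Uu; rewrite tg//; have := step m y u Yy Uu; rewrite /b; lra.
- move=> y Yy.
  have e_right : e m @[m --> \oo] --> 0^'+.
    move=> A [r /= r0 rA]; have [K _ KP] := near_infty_natSinv_lt (PosNum r0).
    exists K => // m /= Km; apply: rA => //=; rewrite sub0r normrN gtr0_norm//.
    exact: le_lt_trans (eI m) (KP m Km).
  have hc : (fine \o (fun m => h_ P Y U f k s (e m) y)) m @[m --> \oo] --> h y.
    by apply: fine_cvg; exact: (cvg_comp _ _ e_right (h_lim y Yy)).
  have hb m : fine (h_ P Y U f k s (e m) y) - 2 * C * m.+1%:R^-1 <=
      e m * w m y - C * b m ^+ N m <= fine (h_ P Y U f k s (e m) y).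
    have e01 : 0 < e m <= 1 by rewrite e0 ltW.
    have [] := discounted_value_bounds (N m) e01 Yy; rewrite -/(b m) -/(w m).
    case: (h_ _ _ _ _ _ _ _ _) => [r| |] //=; rewrite !lee_fin => h1 h2.
    have h3 := ler_wpM2l C0 (NP m); apply/andP; split; last exact: h1.
    by move: h2 h3; move: (m.+1%:R^-1) (C * b m ^+ N m) => i c; lra.
  apply: (@squeeze_cvgr _ _ _ _ (fun m => fine (h_ P Y U f k s (e m) y) - 2 * C * m.+1%:R^-1)
    (fun m => fine (h_ P Y U f k s (e m) y))).
  + exact: nearW.
  + by rewrite -[X in _ --> X]subr0; apply: cvgB => //; exact: cvg_inv_cst.
  + exact: hc.
- exact: cvg_inv_cst.
- move=> m y u Yy Uu; rewrite tg//.
  have := ler_wpM2l (ltW (e0 m)) (step m y u Yy Uu).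
  have et : `|e m * transition (w m) y u| <= C.
    rewrite -transitionZ//; apply: transition_bounded => //; first exact: bounded_lscZ.
    by move=> z Yz; exact: ew.
  have kC := k_bound u Yy.
  have bN1 : b m ^+ N m <= 1 by rewrite exprn_ile1.
  have h1 : e m * k y u <= e m * C.
    by apply: ler_wpM2l; [exact: ltW|exact: le_trans (ler_norm _) kC].
  have h2 : - (e m * (e m * transition (w m) y u)) <= e m * C.
    rewrite -mulrN; apply: ler_wpM2l; first exact: ltW.
    by move: et; rewrite ler_norml => /andP[]; rewrite lerNl.
  have h3 : e m * (b m ^+ N m * C) <= e m * C.
    by apply: ler_wpM2l; [exact: ltW|rewrite ler_piMl].
  have h4 : e m * C <= m.+1%:R^-1 * C by rewrite ler_wpM2r.
  rewrite !mulrDr [e m * (b m * _)]mulrCA {1}/b mulrBl mul1r.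
  by move: h1 h2 h3 h4; move: (e m * transition (w m) y u) (m.+1%:R^-1) => a i; lra.
move=> y0 mu psi eta Yy0 feas; have [_ ceta _] := feas.
have [_ [Me eM]] := seq_continuous_bounded_lsc ceta.
have Me0 : 0 <= Me by exact: le_trans (eM y0 Yy0).
(* [|mu|] pays for the geometric sum falling short by [b m ^+ N m], [C] for the term subtracted in
   [g m], and [2 * Me] for [eta]. *)
exists (fun m => (`|mu| + C + 2 * Me) * m.+1%:R^-1); first exact: cvg_inv_cst.
move=> m.
have b01 : 0 <= b m <= 1 by rewrite b0 b1.
have := dual_lower_bound (N m) b01 Yy0 feas eM; rewrite subrK -/(w m) => H.
have := ler_wpM2l (ltW (e0 m)) H; rewrite mulrBr mulrDr mulrA geo => H1.
have eta0 : - Me <= eta y0 by have := eM y0 Yy0; rewrite ler_norml => /andP[].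
have h1 := ler_wpM2l (ltW (e0 m)) eta0.
have h2 : e m * Me <= m.+1%:R^-1 * Me by rewrite ler_wpM2r.
have h3 := ler_wpM2l C0 (NP m).
have h4 : b m ^+ N m * mu <= m.+1%:R^-1 * `|mu|.
  apply: (@le_trans _ _ (b m ^+ N m * `|mu|)).
    by apply: ler_wpM2l => //; exact: ler_norm.
  by apply: ler_wpM2r (NP m).
by move: H1 h1 h2 h3 h4; move: (m.+1%:R^-1) => i; lra.
Qed.

End duality.

End controlled_system.

(** * From the topological hypotheses to their sequential forms *)

Lemma usc_graph_seq (R : realType) (X : topologicalType) (V : metricType R)
    (Y : set X) (U : X -> set V) :
  (forall y, Y y -> compact (U y)) -> upper_semicontinuous_on Y U ->
  forall (y : nat -> X) (u : nat -> V) y0 u0, (forall n, Y (y n)) ->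
    (forall n, U (y n) (u n)) -> Y y0 -> y n @[n --> \oo] --> y0 ->
    u n @[n --> \oo] --> u0 -> U y0 u0.
Proof.
move=> cU usc y u y0 u0 Yy Uu Yy0 yl ul.
have clU : closed (U y0) := compact_closed (@metric_hausdorff _ _) (cU _ Yy0).
apply: contrapT => nU.
have /nbhs_ballP[e /= e0 eU] : nbhs u0 (~` U y0) by apply: open_nbhs_nbhs; split => //; exact: closed_openC.
(* Halving the radius leaves an open neighbourhood of [U y0] away from [u0], which must contain
   [U (y n)] for large [n]. *)
have [|N _ NP] := yl _ (usc y0 Yy0 (~` closure (ball u0 (e / 2))) (closed_openC (@closed_closure _ _)) _).
  move=> z Uz cz; have e2 : 0 < e / 2 by rewrite divr_gt0.
  have [x [ux zx]] := cz _ (nbhsx_ballx z _ e2).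
  by apply: (eU z) Uz; exact: ball_split ux (ball_sym zx).
have [M _ MP] := ul _ (nbhsx_ballx u0 (e / 2) (divr_gt0 e0 (ltr0Sn _ 1))).
pose m := maxn N M.
apply: (NP m (leq_maxl _ _) (Yy m) _ (Uu m)).
by apply: subset_closure; exact: (MP m (leq_maxr _ _)).
Qed.

Lemma within_pair_seq (X V Z : topologicalType) (Y : set X) (g : X -> V -> Z) :
  {within Y `*` [set: V], continuous (fun p => g p.1 p.2)} ->
  forall (y : nat -> X) (u : nat -> V) y0 u0, (forall n, Y (y n)) -> Y y0 ->
    y n @[n --> \oo] --> y0 -> u n @[n --> \oo] --> u0 ->
    g (y n) (u n) @[n --> \oo] --> g y0 u0.
Proof.
move=> cg y u y0 u0 Yy Yy0 yl ul.
exact: (within_continuous_seq cg (x := fun n => (y n, u n)) (l := (y0, u0))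
  (fun n => conj (Yy n) I) (conj Yy0 I) (cvg_pair yl ul)).
Qed.

Lemma within_pair_bounded (R : realType) (X V : topologicalType) (Y : set X) (g : X -> V -> R) :
  compact Y -> compact [set: V] ->
  {within Y `*` [set: V], continuous (fun p => g p.1 p.2)} ->
  exists C, forall y u, Y y -> `|g y u| <= C.
Proof.
move=> cY cV cg.
have /compact_bounded [M [_ MP]] := continuous_compact cg (compact_setX cY cV).
exists (M + 1) => y u Yy; apply: (MP (M + 1)); first by rewrite ltrDl.
by exists (y, u).
Qed.

Theorem theorem4p4 (R : realType) (n : nat)
  (Y : set 'rV[R]_n) (Uhat : metricType R) (S : topologicalType)
  (f : 'rV[R]_n -> Uhat -> S -> 'rV[R]_n)
  (d : measure_display) (Om : measurableType d) (P : probability Om R)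
  (s : nat -> Om -> S) (U : 'rV[R]_n -> set Uhat) (k : 'rV[R]_n -> Uhat -> R)
  (Y_nonempty : Y !=set0) (Y_compact : compact Y)
  (Uhat_compact : compact [set: Uhat])
  (S_polish : polish_space R S)
  (f_bounded : exists M : R, forall y u x, Y y -> `|f y u x| <= M)
  (f_continuous : forall x,
     {within Y `*` [set: Uhat], continuous (fun p => f p.1 p.2 x)})
  (f_borel : forall y u, Y y -> forall B, borel B -> borel (f y u @^-1` B))
  (s_iid : iid P s)
  (U_nonempty : forall y, Y y -> U y !=set0)
  (U_compact : forall y, Y y -> compact (U y))
  (U_usc : upper_semicontinuous_on Y U)
  (f_viable : forall y u x, Y y -> U y u -> Y (f y u x))
  (k_continuous :
     {within Y `*` [set: Uhat], continuous (fun p => k p.1 p.2)}) :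
  (forall v : 'rV[R]_n -> R,
     (forall y0, Y y0 -> v_ P Y U f k s T y0 @[T --> \oo] --> (v y0)%:E) ->
     {within Y, continuous v} ->
     forall y0, Y y0 -> (v y0)%:E = dual_value P Y U f k s y0) /\
  (forall h : 'rV[R]_n -> R,
     (forall y0, Y y0 -> h_ P Y U f k s eps y0 @[eps --> 0^'+] --> (h y0)%:E) ->
     {within Y, continuous h} ->
     forall y0, Y y0 -> (h y0)%:E = dual_value P Y U f k s y0).
Proof.
have f_cont x := @within_pair_seq _ _ _ Y (fun y u => f y u x) (f_continuous x).
have k_cont := within_pair_seq k_continuous.
have [C k_bound] := within_pair_bounded Y_compact Uhat_compact k_continuous.
have U_graph := usc_graph_seq U_compact U_usc.
split => [v v_lim cv|h h_lim ch] y0 Yy0.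
  apply: (average_duality Y_nonempty Y_compact Uhat_compact f_cont f_borel s_iid
    f_viable U_nonempty U_graph k_cont k_bound v_lim) => //.
  by move=> y l Yy Yl; exact: (within_continuous_seq cv Yy Yl).
apply: (discounted_duality Y_nonempty Y_compact Uhat_compact f_cont f_borel s_iid
  f_viable U_nonempty U_graph k_cont k_bound h_lim) => //.
by move=> y l Yy Yl; exact: (within_continuous_seq ch Yy Yl).
Qed.
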